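(* Let $\mathbb{F}$ be a field of prime power order $q\equiv 1\pmod 4$ such that $\operatorname{char}(\mathbb{F})\ne 5$. If $q\ne 17$, then there exists $a\in\mathbb{F}$ such that $Q_{a,1-a}$ is a maximally nonassociative quasigroup.
   Context: An element $x\in\mathbb{F}$ is a square if $x=y^2$ for some $y\in\mathbb{F}$ (so $0$ is a square); otherwise it is a nonsquare. For $a,b\in\mathbb{F}$ let $\psi\colon\mathbb{F}\to\mathbb{F}$ be given by $\psi(x)=ax$ if $x$ is a square and $\psi(x)=bx$ if $x$ is a nonsquare. $Q_{a,b}$ denotes the set $\mathbb{F}$ with the operation $x*y=x+\psi(y-x)$, in the case that $\psi$ is an orthomorphism of $(\mathbb{F},+)$, i.e. both $\psi$ and $x\mapsto\psi(x)-x$ are permutations of $\mathbb{F}$; then $Q_{a,b}$ is a quasigroup. Saying that $Q_{a,b}$ is a maximally nonassociative quasigroup includes the assertion that $\psi$ is an orthomorphism. A quasigroup is a set $Q$ with a binary operation $*$ such that for all $c,d\in Q$ the equations $x*c=d$ and $c*y=d$ have unique solutions; it is maximally nonassociative if for all $x,y,z\in Q$, $x*(y*z)=(x*y)*z$ implies $x=y=z$. *)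

(* Defs.v *)
From mathcomp Require Import all_boot all_algebra.

Set Implicit Arguments.
Unset Strict Implicit.
Unset Printing Implicit Defensive.

Import GRing.Theory.
Local Open Scope ring_scope.

Definition quasigroup (Q : Type) (op : Q -> Q -> Q) : Prop :=
  forall c d : Q, (exists! x, op x c = d) /\ (exists! y, op c y = d).

Definition maximally_nonassociative (Q : Type) (op : Q -> Q -> Q) : Prop :=
  forall x y z : Q, op x (op y z) = op (op x y) z -> x = y /\ y = z.

Definition orthomorphism (V : zmodType) (f : V -> V) : Prop :=
  bijective f /\ bijective (fun x => f x - x).

Definition is_square (F : finFieldType) (x : F) : bool :=
  [exists y : F, x == y ^+ 2].

Definition psi (F : finFieldType) (a b x : F) : F :=
  if is_square x then a * x else b * x.

Definition Qop (F : finFieldType) (a b x y : F) : F :=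
  x + psi a b (y - x).

(* Q_{a,b} is only defined when psi a b is an orthomorphism, so that condition
   is part of the assertion. *)
Definition Q_maximally_nonassociative_quasigroup
    (F : finFieldType) (a b : F) : Prop :=
  [/\ orthomorphism (psi a b), quasigroup (Qop a b)
    & maximally_nonassociative (Qop a b)].

(* Main.v *)
Require Import Defs.
From Stdlib Require Import PArith NArith.
From mathcomp Require Import all_boot all_order all_algebra all_fingroup all_solvable all_field.
From mathcomp Require Import zify ring.

Set Implicit Arguments.
Unset Strict Implicit.
Unset Printing Implicit Defensive.

Import Order.TTheory GRing.Theory Num.Theory.
Local Open Scope ring_scope.

(** Write [b = 1 - a], [chi] for the quadratic character of [F], and
    [h = (q - 1) / 2].  By translation, and by scaling with squares (a
    nonsquare exchanges [a] and [b]), an associative triple of [Q_{a,b}] is a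
    solution [z] of a single equation which is linear in [z] once three values
    of [chi] are prescribed.  Solving the eight linear equations shows that
    maximal nonassociativity only depends on the values of [chi] at [a], [b],
    [a^2 + a - 1], [b^2 + b - 1], [a^3 - a^2 + 2a - 1], [b^3 - b^2 + 2b - 1].
    For large [q] a suitable [a] exists because the sums of [chi (f x)] over
    [F], for [f] a product of these polynomials, are small: this is Stepanov's
    method, with Hasse derivatives so that it applies to every finite field.
    For [q < 17681] a witness is listed for each [q] and checked in
    [F_p[t] / (m)], where [m] divides [t^q - t]. *)

(** * Hasse derivatives *)

(** The choice b = 1 - a gives psi_{a,b}(x) - x = - psi_{b,a}(x), so chi a = chi b = -1 settles both
    halves of the orthomorphism condition. From q = 1 mod 4, h is even, hence chi(-1) = 1 and psi is
    odd. In characteristic 5, a^2 + a - 1 = (a + 3)^2, so its character sum is not small. The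
    obstacle is the size of the error terms: each further factor in a product of polynomials raises
    its degree, hence the threshold above which the estimate succeeds. The indicator of a full
    pattern of the six characters would involve products of degree 12. It is replaced by an integer
    weight whose expansion stops at degree 8, which leaves few enough fields for direct
    computation. *)

Lemma nderivnM (R : comNzRingType) (p r : {poly R}) n :
  (p * r)^`N(n) = \sum_(i < n.+1) p^`N(i) * r^`N(n - i).
Proof.
have derMX (s : {poly R}) m : (s * 'X)^`N(m.+1) = s^`N(m) + s^`N(m.+1) * 'X.
  by have := nderivnMXaddC m s 0; rewrite polyC0 addr0.
elim/poly_ind: p n => [|p c IHp] [|n].
- by rewrite big_ord1 !nderivn0.
- by rewrite mul0r big1 ?linear0 // => i _; rewrite linear0 mul0r.
- by rewrite big_ord1 !nderivn0.
rewrite mulrDl mulrAC nderivnD derMX mul_polyC nderivnZ !IHp.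
rewrite [X in _ + X * _ + _]big_ord_recl [RHS]big_ord_recl !nderivn0 !subn0.
under [in RHS]eq_bigr => i _ do rewrite nderivnMXaddC mulrDl.
rewrite big_split /= mulrDl mulr_suml -mul_polyC.
rewrite [X in _ = _ + (_ + X)](eq_bigr (fun i : 'I__ => p^`N(bump 0 i) * r^`N(n.+1 - bump 0 i) * 'X)).
  by ring.
by move=> i _; rewrite mulrAC.
Qed.

(** Peel off one factor [f]: in the Leibniz sum the term [i = 0] keeps it, and for [i > 0] at most k
    - 1 derivatives reach the remaining power, which already suffices. *)
Lemma dvdp_exp_nderivn (F : fieldType) (f p : {poly F}) n k :
  f ^+ (n - k) %| (f ^+ n * p)^`N(k).
Proof.
elim: n k => [|n IHn] k; first by rewrite sub0n expr0 dvd1p.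
rewrite exprS -mulrA nderivnM; apply: (big_ind (fun u => _ %| u)) => [||[i le_ik] _] /=.
- exact: dvdp0.
- by move=> u v; apply: dvdp_add.
have [/= -> | i_gt0] := posnP i.
  rewrite nderivn0 subn0; case: (leqP k n) => [le_kn | lt_nk].
    by rewrite subSn // exprS dvdp_mul.
  by rewrite (_ : (n.+1 - k = 0)%N) ?expr0 ?dvd1p //; lia.
apply: dvdp_mull; apply: dvdp_trans (IHn (k - i)%N).
by apply: dvdp_exp2l; lia.
Qed.

Lemma dvdp_XsubC_nderivn (F : fieldType) (p : {poly F}) (x : F) n :
  (forall k, (k < n)%N -> p^`N(k).[x] = 0) -> ('X - x%:P) ^+ n %| p.
Proof.
move=> p0.
have -> : p = \sum_(i < size p) (p^`N(i).[x])%:P * ('X - x%:P) ^+ i.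
  (* Taylor's formula over [{poly F}], at ['X] written as x + ('X - x). *)
  rewrite -[LHS]comp_polyXr -[X in _ \Po X](subrK x%:P) [_ - _ + _]addrC /comp_poly.
  rewrite nderiv_taylor; last exact: mulrC.
  rewrite size_map_polyC; apply: eq_bigr => i _.
  by rewrite nderivn_map horner_map.
apply: (big_ind (fun u => _ %| u)) => [||i _].
- exact: dvdp0.
- by move=> u v; apply: dvdp_add.
have [lt_in | le_ni] := ltnP i n; first by rewrite p0 // mul0r dvdp0.
by rewrite dvdp_mull // dvdp_exp2l.
Qed.

Lemma size_prod_roots_leq (F : finFieldType) (p : {poly F}) (A : {set F}) n :
  p != 0 -> (forall x, x \in A -> ('X - x%:P) ^+ n %| p) ->
  (n * #|A| < size p)%N.
Proof.
move=> p_neq0 dvA.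
suff /dvdp_leq : \prod_(x in A) ('X - x%:P) ^+ n %| p.
  rewrite size_prod => [/(_ p_neq0) | x _]; last by rewrite expf_neq0 // polyXsubC_eq0.
  under eq_bigr => x _ do rewrite size_exp_XsubC.
  rewrite sum_nat_const [X in (_ - X)%N](_ : _ = #|A|); last exact: eq_card.
  by rewrite mulnS subSn ?leq_addr // addKn mulnC.
rewrite big_mkcond -big_enum /=.
elim: (enum _) (enum_uniq F) => [|x s IHs] /=; first by rewrite big_nil dvd1p.
case/andP=> xs us; rewrite big_cons; case: ifP => [xA | _]; last by rewrite mul1r IHs.
rewrite Gauss_dvdp ?dvA ?IHs // coprimep_expl // big_seq.
apply: (big_ind (fun u => coprimep _ u)) => [||y ys].
- exact: coprimep1.
- by move=> u v; rewrite coprimepMr => -> ->.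
case: ifP => _; last exact: coprimep1.
rewrite coprimep_expr // coprimep_XsubC root_XsubC.
by apply: contraNneq xs => <-.
Qed.

Section FrobeniusPowers.
Variable F : finFieldType.
Implicit Types (x : F) (p : {poly F}).
Local Notation q := #|F|.

Lemma pchar_pnat_card : [pchar F].-nat q.
Proof.
have [p p_pr pF] := finPcharP F.
rewrite (eq_pnat _ (pcharf_eq pF)).
by rewrite (card_pprimeChar pF) pnatX pnat_id ?orbT //.
Qed.

Lemma exprD_card (x y : {poly F}) : (x + y) ^+ q = x ^+ q + y ^+ q.
Proof.
by apply: exprDn_pchar; rewrite (eq_pnat _ (@pchar_poly F)) pchar_pnat_card.
Qed.

Lemma exp_card_poly p : p ^+ q = p \Po 'X^q.
Proof.
elim/poly_ind: p => [|p c IHp].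
  rewrite comp_poly0 expr0n gtn_eqF //.
  by apply/card_gt0P; exists 0.
by rewrite exprD_card exprMn IHp -polyC_exp expf_card comp_polyD comp_polyM comp_polyX comp_polyC.
Qed.

(** ['X^q] is a constant for Hasse derivatives of order below q, because the inner binomial
    coefficients of q vanish in [F]. High powers of ['X^q] can thus enter the auxiliary polynomial
    without complicating its derivatives. *)
Lemma nderivn_mulXq p j k :
  (k < q)%N -> (p * 'X^(q * j))^`N(k) = p^`N(k) * 'X^(q * j).
Proof.
have bin0 i : (0 < i < q)%N -> 'C(q, i)%:R = 0 :> F.
  case/andP=> i_gt0 i_lt; have := exprD_card 'X 1.
  move/(congr1 (fun u : {poly F} => u`_i)); rewrite expr1n exprD1n coef_sum.
  rewrite (bigD1 (Ordinal (ltnW i_lt : i < q.+1)%N)) //= big1 => [|j' /= neq].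
    rewrite coefMn coefXn eqxx addr0 coefD coefXn coef1.
    by rewrite (ltn_eqF i_lt) (gtn_eqF i_gt0) addr0.
  by rewrite coefMn coefXn; case: eqP => [eq_ij|]; rewrite ?mul0rn //; case/eqP: neq; apply/val_inj.
elim: j => [|j IHj] in p * => lt_kq; first by rewrite muln0 !mulr1.
rewrite mulnS exprD mulrA IHj // nderivnM big_ord_recr /= subnn nderivn0.
rewrite big1 ?add0r ?mulrA // => -[i /= lt_ik] _.
by rewrite nderivnXn -mulr_natr -polyC_natr bin0 ?polyC0 ?mulr0 //; lia.
Qed.
End FrobeniusPowers.

(** * Stepanov's bound *)

(** Uniqueness of expansions in base X^n: blocks of degree below n do not overlap. *)
Lemma horner_Xn_eq0 (R : idomainType) n (U : {poly {poly R}}) : (0 < n)%N ->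
  (forall j, (size (U`_j)%R <= n)%N) -> U.['X^n] = 0 -> U = 0.
Proof.
move=> n_gt0; elim/poly_ind: U => // U c IHU szU.
rewrite hornerMXaddC => Uc0; have szc := szU 0%N.
rewrite coefD coefMX coefC eqxx add0r in szc.
have U0 : U.['X^n] = 0.
  apply: contraTeq (szc) => nzU; rewrite -ltnNge.
  have := canRL (addrK _) Uc0; rewrite sub0r => /(congr1 (fun p => size (polyseq p))).
  rewrite size_polyN size_mulXn // => <-.
  by rewrite -addn1 leq_add2l size_poly_gt0.
move: Uc0; rewrite U0 mul0r add0r => c0.
rewrite (IHU _ U0) ?mul0r ?c0 ?addr0 // => j.
by have := szU j.+1; rewrite coefD coefMX coefC /= addr0.
Qed.

Lemma size_coefM_leq (R : idomainType) (U V : {poly {poly R}}) a b :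
    (forall j, (size (U`_j)%R <= a.+1)%N) -> (forall j, (size (V`_j)%R <= b.+1)%N) ->
  forall j, (size ((U * V)`_j)%R <= (a + b).+1)%N.
Proof.
move=> szU szV j; rewrite coefM; apply: leq_trans (size_sum _ _ _) _.
apply/bigmax_leqP => i _; apply: leq_trans (size_polyMleq _ _) _.
by have := szU i; have := szV (j - i)%N; lia.
Qed.

Section Stepanov.
Variables (F : finFieldType) (f : {poly F}) (h e : nat).
Local Notation q := #|F|.
Hypothesis q_eq : q = (2 * h + 1)%N.
Hypothesis size_f : (size f <= 2 * e + 1)%N.
Hypothesis le_eh : (e <= h)%N.
(** [f] is not a constant times a square in F(X). In [stepanov_nonvanishing] the constant is the
    leading coefficient of [f]. *)
Hypothesis f_nsq : forall c (p r : {poly F}), f * p ^+ 2 = c *: r ^+ 2 -> p = 0.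

Let f_neq0 : f != 0.
Proof.
apply/eqP=> f0; have := @f_nsq 0 1 0.
by rewrite f0 mul0r scale0r => /(_ erefl)/eqP; rewrite oner_eq0.
Qed.

(* Squaring [U(X^q) = - f^h V(X^q)] and multiplying by [f] turns [f^q] into
   [f(X^q)]; the degrees are small enough to replace [X^q] by a second
   variable [Y], and the leading coefficients in [Y] contradict [f_nsq]. *)
Lemma stepanov_nonvanishing (U V : {poly {poly F}}) :
    (forall j, (size (U`_j)%R <= h + 1 - e)%N) -> (forall j, (size (V`_j)%R <= h + 1)%N) ->
  U.['X^q] + f ^+ h * V.['X^q] = 0 -> U = 0 /\ V = 0.
Proof.
move=> szU szV UV0.
have E0 : f%:P * U ^+ 2 = f^:P * V ^+ 2.
  apply/subr0_eq/(@horner_Xn_eq0 _ q); first by rewrite q_eq addn1.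
    (* The X-degrees are at most 2e + 2(h - e) on one side and 2h on the other, both equal to q - 1;
       this dictates the bounds on [U] and [V]. *)
    move=> j; rewrite coefB (leq_trans (size_polyD _ _)) // size_polyN geq_max.
    have szf1 i : (size (f%:P`_i)%R <= (2 * e).+1)%N.
      by rewrite coefC; case: eqP => _; rewrite ?size_poly0 // -addn1.
    have szf2 i : (size (f^:P`_i)%R <= 1)%N.
      by rewrite coef_map size_polyC_leq1.
    have szU' i : (size (U`_i)%R <= (h - e).+1)%N by have := szU i; lia.
    have szV' i : (size (V`_i)%R <= h.+1)%N by have := szV i; lia.
    have := size_coefM_leq szf1 (size_coefM_leq szU' szU') j.
    have := size_coefM_leq szf2 (size_coefM_leq szV' szV') j.
    rewrite -!expr2 q_eq => s1 s2.
    by rewrite (leq_trans s2) ?(leq_trans s1) //; lia.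
  have -> : (f%:P * U ^+ 2 - f^:P * V ^+ 2).['X^q]
            = f * U.['X^q] ^+ 2 - f ^+ q * V.['X^q] ^+ 2.
    by rewrite (exp_card_poly f) hornerD hornerN (hornerM f%:P) (hornerM f^:P) !horner_exp hornerC.
  rewrite (canRL (addrK _) UV0) q_eq sub0r sqrrN exprMn -exprM mulrA -exprS.
  by rewrite mulnC addn1 subrr.
have U0 : U = 0.
  apply/eqP; rewrite -lead_coef_eq0; apply/eqP.
  have := congr1 lead_coef E0.
  rewrite (lead_coefM f%:P) (lead_coefM f^:P) !lead_coef_exp lead_coefC lead_coef_map_eq ?polyC_eq0 ?lead_coef_eq0 //.
  by rewrite mul_polyC; apply: f_nsq.
split=> //; apply/eqP; move/esym/eqP: E0.
by rewrite U0 expr0n mulr0 mulf_eq0 map_polyC_eq0 (negPf f_neq0) expf_eq0.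
Qed.

Definition stepanov_quot n k (p : {poly F}) := (f ^+ n * p)^`N(k) %/ f ^+ (n - k).

Lemma stepanov_quotK n k p :
  stepanov_quot n k p * f ^+ (n - k) = (f ^+ n * p)^`N(k).
Proof. by rewrite divpK // dvdp_exp_nderivn. Qed.

Lemma stepanov_quotB n k : {morph stepanov_quot n k : p r / p - r}.
Proof.
by move=> p r; rewrite /stepanov_quot mulrBr nderivnB divpD divpN.
Qed.

(** Each derivative lowers the degree by one but leaves one factor [f], of degree at most 2e,
    undivided: a net cost of 2e - 1. *)
Lemma size_stepanov_quot n k p : (k <= n)%N -> (0 < e)%N ->
  (size (stepanov_quot n k p) <= size p + k * (2 * e - 1))%N.
Proof.
move=> le_kn e_gt0; have [-> | p_neq0] := eqVneq p 0.
  by rewrite /stepanov_quot mulr0 linear0 div0p size_poly0.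
rewrite size_divp ?expf_neq0 // size_exp.
have : (size ((f ^+ n * p)^`N(k))%R <= size (f ^+ n * p)%R - k)%N by apply: size_poly.
have := size_exp f n; rewrite -[in RHS](subnKC le_kn) mulnDr.
rewrite size_mul ?expf_neq0 //.
have : (0 < size p)%N by rewrite size_poly_gt0.
have : (0 < size (f ^+ n)%R)%N by rewrite size_poly_gt0 expf_neq0.
have : ((size f).-1 * k <= 2 * e * k)%N by rewrite leq_mul2r; apply/orP; right; lia.
rewrite (mulnBr k) muln1 (mulnC k); have : (k <= 2 * e * k)%N by rewrite leq_pmull // muln_gt0.
by move: (size _) (size _) (size _) ((size f).-1 * k)%N ((size f).-1 * (n - k))%N (2 * e * k)%N => *; lia.
Qed.

Definition stepanov_form J1 J2 (p : 'I_J1 -> {poly F}) (r : 'I_J2 -> {poly F}) :=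
  \sum_(j < J1) p j * 'X^(q * j) + f ^+ h * \sum_(j < J2) r j * 'X^(q * j).

(* The [k]-th Hasse derivative of [f ^+ l * stepanov_form p r], divided by
   [f ^+ (l - k)], agrees with this polynomial at each root [x] of
   [f ^+ h - eps], because [x ^+ q = x]. *)
Definition stepanov_constraint eps l k J1 J2
    (p : 'I_J1 -> {poly F}) (r : 'I_J2 -> {poly F}) :=
  \sum_(j < J1) stepanov_quot l k (p j) * 'X^j
  + eps *: \sum_(j < J2) stepanov_quot (l + h) k (r j) * 'X^j.

Lemma stepanov_vanishing eps l J1 J2 (p : 'I_J1 -> {poly F}) (r : 'I_J2 -> {poly F}) x :
    eps != 0 -> (l <= q)%N ->
    (forall k, (k < l)%N -> stepanov_constraint eps l k p r = 0) ->
    f.[x] ^+ h = eps ->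
  ('X - x%:P) ^+ l %| stepanov_form p r.
Proof.
move=> nz_eps le_lq C0 fx.
have nz_fx : f.[x] != 0.
  apply: contraNneq nz_eps => f0; rewrite -fx f0 expr0n.
  case: h q_eq => // q1; have := finNzRing_gt1 F; by rewrite q1.
have cop : coprimep (('X - x%:P) ^+ l) (f ^+ l).
  by rewrite coprimep_expl // coprimep_expr // coprimep_sym coprimep_XsubC.
(* The factor [f ^+ l] is prime to ['X - x%:P], so it does not affect the multiplicity at x; it
   gives both sums the common factor [f ^+ (l - k)] after differentiation. *)
rewrite -(Gauss_dvdpr _ cop) dvdp_XsubC_nderivn // => k lt_kl.
have xq j : x ^+ (q * j) = x ^+ j by rewrite exprM expf_card.
rewrite mulrDr mulrA -exprD !mulr_sumr nderivnD !raddf_sum /=.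
rewrite hornerD !horner_sum.
have quotE n s j : (l <= n)%N -> (f ^+ n * (s * 'X^(q * j)))^`N(k).[x] =
    (stepanov_quot n k s * 'X^j).[x] * f.[x] ^+ (n - k).
  move=> le_ln; rewrite mulrA nderivn_mulXq ?(leq_trans lt_kl) // -stepanov_quotK.
  by rewrite !hornerM !horner_exp !hornerX xq mulrAC.
under eq_bigr => j _ do rewrite quotE //.
under [X in _ + X]eq_bigr => j _ do rewrite quotE ?leq_addr //.
rewrite -!mulr_suml -addnBAC 1?ltnW // exprD fx mulrA mulrAC -mulrDl.
rewrite mulrC; move: (C0 k lt_kl) => /(congr1 (fun u : {poly F} => u.[x])).
rewrite horner0 /stepanov_constraint hornerD hornerZ !horner_sum => E.
by rewrite [X in _ * (_ + X)]mulrC E mulr0.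
Qed.

Lemma sum_arith l c d : (2 * \sum_(k < l) (c + k * d) + d * l = 2 * c * l + d * l * l)%N.
Proof.
elim: l => [|l IHl]; first by rewrite big_ord0 !muln0.
by rewrite big_ord_recr /=; move: IHl; move: (\sum_(i < l) _)%N => S; nia.
Qed.

(* The constraints are fewer linear conditions than there are coefficients:
   this is where the ranges [m + e] and [m] of the two exponents of [X^q] and
   the degree bounds [h + 1 - e] and [h + 1] are balanced. *)
Lemma stepanov_kernel eps m : (0 < e)%N -> (4 * m ^ 2 + e <= h)%N ->
  exists M : 'M[F]_(m + e, h + 1 - e), exists N : 'M[F]_(m, h + 1),
    (M != 0) || (N != 0) /\
    forall k, (k < 2 * m)%N ->
      stepanov_constraint eps (2 * m) k (fun j => rVpoly (row j M)) (fun j => rVpoly (row j N)) = 0.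
Proof.
move=> e_gt0 le_h; set l := (2 * m)%N.
pose n (k : 'I_l) := (h + m + k * (2 * e - 1))%N.
pose C k (u : 'M[F]_(m + e, h + 1 - e) * 'M[F]_(m, h + 1)) :=
  stepanov_constraint eps l k (fun j => rVpoly (row j u.1)) (fun j => rVpoly (row j u.2)).
have CB k u v : C k (u - v) = C k u - C k v.
  rewrite /C /stepanov_constraint opprD addrACA -scalerBr -!sumrB.
  by congr (_ + _ *: _); apply: eq_bigr => j _; rewrite /= !linearB /= stepanov_quotB mulrBl.
have szC (k : 'I_l) u : (size (C k u) <= n k)%N.
  have szQ i j a (v : 'rV[F]_a) : (l <= i)%N -> (a + j <= h + m)%N ->
      (size (stepanov_quot i k (rVpoly v) * 'X^j)%R <= n k)%N.
    move=> le_li le_aj; apply: leq_trans (size_polyMleq _ _) _.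
    have := @size_stepanov_quot i k (rVpoly v) (leq_trans (ltnW (ltn_ord k)) le_li) e_gt0.
    have : (size (rVpoly v) <= a)%N by apply: size_poly.
    by rewrite size_polyXn /n; lia.
  apply: leq_trans (size_polyD _ _) _; rewrite geq_max; apply/andP; split.
    apply: leq_trans (size_sum _ _ _) _; apply/bigmax_leqP => j _.
    by apply: szQ => //; have := ltn_ord j; lia.
  apply: leq_trans (size_scale_leq _ _) _.
  apply: leq_trans (size_sum _ _ _) _; apply/bigmax_leqP => j _.
  by apply: szQ; rewrite ?leq_addr //; have := ltn_ord j; lia.
pose Phi u := [ffun i : {k : 'I_l & 'I_(n k)} => (C (tag i) u)`_(tagged i)].
(* Pigeonhole in place of a rank argument: two pairs with the same constraint coefficients differ by
   a nonzero element of the kernel. *)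
have /injectivePn [u [v neq_uv eq_Phi]] : ~~ injectiveb Phi.
  apply/negP => /injectiveP /leq_card; apply/negP; rewrite -ltnNge.
  rewrite card_prod !card_mx card_ffun card_tagged sumnE big_map big_enum /=.
  under eq_bigr => k _ do rewrite card_ord.
  rewrite -expnD ltn_exp2l ?finNzRing_gt1 //.
  (* Unknowns exceed conditions by m + e(h + 1 + m - e - 4m^2), which is positive since 4m^2 + e <=
     h. *)
  have := sum_arith l (h + m) (2 * e - 1); rewrite /n /l.
  move: (\sum_(k < _) _)%N => S.
  have [t ->] : exists t, h = (4 * m ^ 2 + e + t)%N by exists (h - (4 * m ^ 2 + e))%N; lia.
  case: e e_gt0 => // e1 _.
  have -> : (4 * m ^ 2 + e1.+1 + t + 1 - e1.+1 = 4 * m ^ 2 + t + 1)%N by lia.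
  have -> : (2 * e1.+1 - 1 = 2 * e1 + 1)%N by lia.
  by rewrite -mulnn; nia.
exists (u - v).1; exists (u - v).2; split.
  rewrite -negb_and; apply: contraNN neq_uv => /andP[/eqP u1 /eqP u2].
  by rewrite -subr_eq0 [u - v]surjective_pairing u1 u2.
move=> k lt_kl; rewrite -/l -/(C k (u - v)) CB; apply/polyP => i.
rewrite coefB coef0.
have [lt_in | le_ni] := ltnP i (n (Ordinal lt_kl)); last first.
  have C0 w : (C k w)`_i = 0.
    by apply: nth_default; apply: leq_trans (szC (Ordinal lt_kl) w) le_ni.
  by rewrite !C0 subrr.
have /ffunP/(_ (Tagged (fun k => 'I_(n k)) (Ordinal lt_in))) := eq_Phi.
by rewrite !ffunE /= => ->; rewrite subrr.
Qed.

(** One nonzero polynomial vanishes to order 2m at every solution, so its degree bounds the count.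
    The main term is q / 2, and the error decreases as m grows up to the order of sqrt q. *)
Theorem stepanov eps m : (0 < e)%N -> (4 * m ^ 2 + e <= h)%N -> eps != 0 ->
  (2 * m * #|[set x | f.[x] ^+ h == eps]| <= (m + e - 1) * q + h - e)%N.
Proof.
move=> e_gt0 le_h nz_eps.
have [-> // | m_gt0] := posnP m.
have [M [N [nzMN CMN]]] := stepanov_kernel eps e_gt0 le_h.
set p := (fun j => rVpoly (row j M)) in CMN *.
set r := (fun j => rVpoly (row j N)) in CMN *.
have szp j : (size (p j) <= h + 1 - e)%N by apply: size_poly.
have szr j : (size (r j) <= h + 1)%N by apply: size_poly.
pose U J (s : 'I_J -> {poly F}) : {poly {poly F}} := \poly_(j < J) oapp s 0 (insub j).
have coefU J (s : 'I_J -> {poly F}) (i : 'I_J) : (U J s)`_i = s i.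
  by rewrite coef_poly ltn_ord valK.
have hornerU J (s : 'I_J -> {poly F}) : (U J s).['X^q] = \sum_(j < J) s j * 'X^(q * j).
  by rewrite horner_poly; apply: eq_bigr => i _; rewrite -exprM valK.
have szU J (s : 'I_J -> {poly F}) n : (forall j, size (s j) <= n)%N ->
    forall i, (size ((U J s)`_i)%R <= n)%N.
  move=> szs i; rewrite coef_poly; case: ifP => _; last by rewrite size_poly0.
  by case: insub => [j|] /=; rewrite ?size_poly0.
have nzH : stepanov_form p r != 0.
  apply: contraTneq nzMN; rewrite /stepanov_form -!hornerU.
  case/(stepanov_nonvanishing (szU _ _ _ szp) (szU _ _ _ szr)) => U0 V0.
  rewrite negb_or !negbK; apply/andP; split; apply/eqP/row_matrixP => j.
    have := coefU _ p j; rewrite U0 coef0 row0.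
    move=> /esym/(congr1 (fun u => poly_rV u : 'rV_(h + 1 - e))).
    by rewrite /p rVpolyK linear0.
  have := coefU _ r j; rewrite V0 coef0 row0.
  move=> /esym/(congr1 (fun u => poly_rV u : 'rV_(h + 1))).
  by rewrite /r rVpolyK linear0.
have le_mq : (2 * m <= q)%N by rewrite q_eq; nia.
have := @size_prod_roots_leq _ _ [set x | f.[x] ^+ h == eps] (2 * m) nzH.
move=> /(_ _)/leq_trans => lt_size; rewrite -ltnS.
apply: lt_size => [x|].
  by rewrite inE => /eqP fx; apply: stepanov_vanishing nz_eps _ _ fx.
have szX n i (s : {poly F}) J : (size s <= i)%N -> (i + q * J <= n)%N -> (size (s * 'X^(q * J))%R <= n)%N.
  move=> szs le_n; apply: leq_trans (size_polyMleq _ _) _.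
  by rewrite size_polyXn; lia.
(* Both sums reach the same degree (m + e - 1)q + h - e: [f ^+ h] has degree at most 2eh = e(q - 1),
   which offsets the e extra powers of ['X^q] in the first sum. *)
apply: leq_trans (size_polyD _ _) _; rewrite geq_max; apply/andP; split.
  apply: leq_trans (size_sum _ _ _) _; apply/bigmax_leqP => j _.
  apply: szX (szp j) _; have := ltn_ord j; move: (val j) => i; nia.
rewrite mulr_sumr; apply: leq_trans (size_sum _ _ _) _; apply/bigmax_leqP => j _.
rewrite mulrA; apply: (szX _ (2 * e * h + h + 1)%N).
  apply: leq_trans (size_polyMleq _ _) _.
  have := size_poly_exp_leq f h; have := szr j.
  have : ((size f).-1 * h <= 2 * e * h)%N by rewrite leq_mul2r; apply/orP; right; lia.
  by lia.
by rewrite q_eq; have := ltn_ord j; move: (val j) => i; nia.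
Qed.
End Stepanov.

(** * Sums of the quadratic character *)

Section QuadraticCharacter.
Variable F : finFieldType.
Implicit Types (x y : F) (f : {poly F}).

Lemma is_squareP x : reflect (exists y, x = y ^+ 2) (is_square x).
Proof. by apply: (iffP existsP) => -[y /eqP]; exists y; rewrite // eq_sym; apply/eqP. Qed.

Definition quad_char x : int :=
  if x == 0 then 0 else if is_square x then 1 else -1.

Variable h : nat.
Hypothesis card_F : #|F| = (2 * h + 1)%N.

Lemma half_gt0 : (0 < h)%N.
Proof. by have := finNzRing_gt1 F; rewrite card_F; case: h. Qed.

Lemma exp_half_sqr x : x != 0 -> (x ^+ h) ^+ 2 = 1.
Proof.
move=> nz_x; apply: (mulfI nz_x).
by rewrite mulr1 -exprM -exprS mulnC -addn1 -card_F expf_card.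
Qed.

Lemma exp_half_pm1 x : x != 0 -> (x ^+ h == 1) || (x ^+ h == -1).
Proof. by move=> nz_x; rewrite -eqf_sqr exp_half_sqr // expr1n. Qed.

Lemma exp_half_eq1 x : x != 0 -> (x ^+ h == 1) = is_square x.
Proof.
move=> nz_x; apply/idP/is_squareP => [/eqP x1 | [y x_eq]]; last first.
  have nz_y : y != 0 by apply: contraNneq nz_x => y0; rewrite x_eq y0 expr0n.
  by rewrite x_eq -exprM mulnC exprM exp_half_sqr.
have /cyclicP [g gE] := field_unit_group_cyclic [set: {unit F}].
have Ux : x \is a GRing.unit by rewrite unitfE.
have /cycleP [k xg] : FinRing.unit F Ux \in <[g]>%g by rewrite -gE inE.
have dvd_kh : (2 * h %| k * h)%N.
  have <- : #[g]%g = (2 * h)%N.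
    by rewrite orderE -gE card_finField_unit card_F addn1.
  rewrite order_dvdn expgM -xg; apply/eqP/val_inj.
  by rewrite /= FinRing.val_unitX /=.
rewrite dvdn_pmul2r ?half_gt0 // in dvd_kh.
exists (val (g ^+ (k %/ 2))%g).
by rewrite -FinRing.val_unitX -expgM divnK // -xg.
Qed.

Lemma quad_charE x : (quad_char x)%:~R = x ^+ h.
Proof.
rewrite /quad_char; have [-> | nz_x] := eqVneq x 0.
  by rewrite expr0n gtn_eqF ?half_gt0.
have := exp_half_pm1 nz_x; rewrite -exp_half_eq1 //.
by case: eqP => [-> | _ /eqP ->].
Qed.

(** Some nonzero y has y^h different from 1, since X^h - 1 cannot have 2h roots; there y^h = -1. *)
Lemma one_neqN1 : 1 != -1 :> F.
Proof.
have [y /andP[nz_y] | y1] := pickP (fun y : F => (y != 0) && (y ^+ h != 1)).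
  by have := exp_half_pm1 nz_y => /orP[/eqP-> /eqP // | /eqP->]; rewrite eq_sym.
have := @max_poly_roots F ('X^h - 1) (enum [set~ 0]).
rewrite -size_poly_eq0 size_Xn_sub_1 ?half_gt0 // enum_uniq -cardE cardsC1 card_F.
move=> max_rs; have rs : all (root ('X^h - 1)) (enum [set~ 0 : F]).
  apply/allP => y; rewrite mem_enum !inE => nz_y.
  have /negbT := y1 y; rewrite nz_y /= negbK => /eqP y_h.
  by rewrite rootE !hornerE y_h subrr.
by move: (max_rs isT rs isT); have := half_gt0; lia.
Qed.

Lemma quad_char_exp x : quad_char x = (x ^+ h == 1)%:R - (x ^+ h == -1)%:R.
Proof.
rewrite -quad_charE /quad_char; case: eqP => _.
  by rewrite eq_sym oner_eq0 eq_sym oppr_eq0 oner_eq0.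
have := one_neqN1; case: is_square => /= neq; first by rewrite eqxx (negPf neq).
by rewrite eq_sym (negPf neq) eqxx.
Qed.

Lemma quad_charM x y : quad_char (x * y) = quad_char x * quad_char y.
Proof.
have [-> | nz_x] := eqVneq x 0; first by rewrite mul0r /quad_char eqxx mul0r.
have [-> | nz_y] := eqVneq y 0; first by rewrite mulr0 /quad_char eqxx mulr0.
have := one_neqN1; rewrite !quad_char_exp exprMn.
case/orP: (exp_half_pm1 nz_x) => /eqP ->; case/orP: (exp_half_pm1 nz_y) => /eqP -> neq;
  by rewrite ?mulrNN ?mulr1 ?mul1r !eqxx ?(eq_sym (-1)) ?(negPf neq).
Qed.

Lemma card_roots_leq f : f != 0 -> (#|[set x | f.[x] == 0%R]| <= (size f).-1)%N.
Proof.
move=> nz_f; have := @max_poly_roots F f (enum [set x | f.[x] == 0]) nz_f.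
rewrite enum_uniq -cardE => /(_ _ isT) lt_size.
suff /lt_size : all (root f) (enum [set x | f.[x] == 0]) by case: (size f).
by apply/allP => x; rewrite mem_enum inE.
Qed.

(** Stepanov's bound is one-sided, but it holds for both values 1 and -1 of f^h. As the two counts
    and the at most 2e zeros add up to q, it bounds their difference on both sides. The factor 2m
    keeps the estimate integral. *)
Lemma quad_char_sum_leq f e m : (0 < e)%N -> (size f <= 2 * e + 1)%N ->
    (4 * m ^ 2 + e <= h)%N ->
    (forall c (p r : {poly F}), f * p ^+ 2 = c *: r ^+ 2 -> p = 0) ->
  `|(2 * m)%:Z * \sum_x quad_char f.[x]| <= ((2 * e - 1) * #|F| + 4 * m * e)%:Z.
Proof.
move=> e_gt0 sz_f le_h nsq.
have nz_f : f != 0.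
  apply/eqP=> f0; have := nsq 0 1 0.
  by rewrite f0 mul0r scale0r => /(_ erefl)/eqP; rewrite oner_eq0.
have card_sum (P : pred F) : \sum_x (P x)%:R = #|[set x | P x]|%:Z :> int.
  rewrite -natr_sum natz -sum1dep_card; congr Posz; rewrite [RHS]big_mkcond.
  by apply: eq_bigr => x _; case: (P x).
have le_eh : (e <= h)%N by lia.
have := stepanov card_F sz_f le_eh nsq e_gt0 le_h (oner_neq0 F).
have := @stepanov _ _ _ _ card_F sz_f le_eh nsq (-1) m e_gt0 le_h.
rewrite oppr_eq0 oner_neq0 => /(_ isT).
have := card_roots_leq nz_f.
set Z := #|_|; set N := #|_|; set P := #|_|.
have cardPNZ : (P + N + Z)%N = #|F|.
  apply/eqP; rewrite -eqz_nat !PoszD -!card_sum -!big_split /=.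
  have <- : \sum_(x : F) 1 = #|F|%:Z by rewrite sumr_const natz.
  apply/eqP/eq_bigr => x _.
  have [-> | nz] := eqVneq f.[x] 0.
    by rewrite expr0n gtn_eqF ?half_gt0 // eq_sym oner_eq0 eq_sym oppr_eq0 oner_eq0.
  have := one_neqN1; case/orP: (exp_half_pm1 nz) => /eqP -> neq.
    by rewrite eqxx (negPf neq) .
  by rewrite eqxx eq_sym (negPf neq).
have -> : \sum_x quad_char f.[x] = P%:Z - N%:Z.
  by rewrite -!card_sum -sumrB; apply: eq_bigr => x _; rewrite quad_char_exp.
move: cardPNZ; rewrite card_F => cardPNZ le_Z.
have {le_Z} le_mZ : (m * Z <= m * (2 * e))%N by rewrite leq_mul2l; apply/orP; right; lia.
have {cardPNZ} : (m * P + m * N + m * Z = 2 * (m * h) + m)%N.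
  by rewrite -!mulnDr cardPNZ mulnDr muln1 mulnCA.
have -> : (2 * m)%N%:Z * (P%:Z - N%:Z) = 2 * ((m * P)%N%:Z - (m * N)%N%:Z).
  by rewrite !PoszM; ring.
move: e_gt0 le_mZ; clear; case: e => // e1 _.
have -> : (m * (2 * e1.+1) = 2 * (m * e1) + 2 * m)%N by ring.
have -> : ((m + e1.+1 - 1) * (2 * h + 1) = 2 * (m * h) + 2 * (e1 * h) + m + e1)%N.
  by rewrite addnS subn1 /=; ring.
have -> : ((2 * e1.+1 - 1) * (2 * h + 1) = 4 * (e1 * h) + 2 * h + 2 * e1 + 1)%N.
  by rewrite mulnS addSn subn1 /=; ring.
rewrite -!mulnA mulnS.
move: (m * Z)%N (m * N)%N (m * P)%N (m * h)%N (e1 * h)%N (m * e1)%N => *; lia.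
Qed.
End QuadraticCharacter.

(** * Existence of admissible elements in large fields *)

(** Cancelling [p] leaves f g = c s^2. For d = gcd(f, s), coprimality of f / d with s / d gives f /
    d | d, and coprimality of d with g gives d | f / d. *)
Lemma coprime_factor_sqr (F : fieldType) (f g p r : {poly F}) c :
    coprimep f g -> f * g != 0 -> p != 0 -> f * g * p ^+ 2 = c *: r ^+ 2 ->
  exists d, f %= d ^+ 2.
Proof.
move=> cop_fg nz_fg nz_p fg_eq.
have nz_c : c != 0.
  apply: contraTneq nz_p => c0; move/eqP: fg_eq.
  by rewrite c0 scale0r mulf_eq0 (negPf nz_fg) expf_eq0 /= => /eqP->; rewrite eqxx.
have /dvdpP [s r_eq] : p %| r.
  by rewrite -(@dvdp_pexp2r _ _ _ 2) // -(dvdpZr _ _ nz_c) -fg_eq dvdp_mull.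
have {fg_eq} fg_eq : f * g = c *: s ^+ 2.
  apply: (mulIf (expf_neq0 2 nz_p)).
  by rewrite fg_eq r_eq exprMn scalerAl.
have nz_f : f != 0 by apply: contraNneq nz_fg => ->; rewrite mul0r.
pose d := gcdp f s; exists d.
have nz_d : d != 0 by rewrite gcdp_eq0 (negPf nz_f).
have f_eq : f = f %/ d * d by rewrite divpK // dvdp_gcdl.
have s_eq : s = s %/ d * d by rewrite divpK // dvdp_gcdr.
have cop : coprimep (f %/ d) (s %/ d) by rewrite coprimep_div_gcd // nz_f.
have {fg_eq} fg_eq : f %/ d * g = d * (c *: (s %/ d) ^+ 2).
  apply: (mulIf nz_d); rewrite mulrAC -f_eq fg_eq {1}s_eq exprMn -!scalerAr -scalerAl.
  by congr (_ *: _); ring.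
rewrite f_eq expr2 eqp_mul2r //; apply/andP; split.
  have : f %/ d %| d * (c *: (s %/ d) ^+ 2) by rewrite -fg_eq dvdp_mulr.
  by rewrite Gauss_dvdpl // coprimepZr // coprimep_expr.
have : d %| f %/ d * g by rewrite fg_eq dvdp_mulr.
by rewrite Gauss_dvdpl // (coprimep_dvdr _ cop_fg) // dvdp_gcdl.
Qed.

(** Even size is odd degree, so [f] cannot be associate to a square. This serves for the factors X,
    1 - X and [cubic 'X]; only [quad 'X] alone requires another argument. *)
Lemma nonsquare_even_size (F : fieldType) (f g : {poly F}) c (p r : {poly F}) :
    coprimep f g -> f * g != 0 -> ~~ odd (size f) ->
  f * g * p ^+ 2 = c *: r ^+ 2 -> p = 0.
Proof.
move=> cop nz_fg even_f fg_eq; apply: contraNeq even_f => nz_p.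
have [d fd] := coprime_factor_sqr cop nz_fg nz_p fg_eq.
have nz_f : f != 0 by apply: contraNneq nz_fg => ->; rewrite mul0r.
have nz_d2 : d ^+ 2 != 0 by rewrite -size_poly_eq0 -(eqp_size fd) size_poly_eq0.
rewrite (eqp_size fd); have := size_exp d 2; move: nz_d2; rewrite -size_poly_gt0.
by case: (size (d ^+ 2)%R) => //= n _ ->; rewrite oddM andbF.
Qed.

(** With b = 1 - a, [quad a] is a^2 - b and [cubic a] is a^3 - b^2. *)
Definition quad (R : pzRingType) (x : R) := x ^+ 2 + x - 1.
Definition cubic (R : pzRingType) (x : R) := x ^+ 3 - x ^+ 2 + x *+ 2 - 1.

(** The discriminant of [quad 'X] is 5, whereas that of a square is 0. *)
Lemma quad_not_sqr (F : fieldType) (d : {poly F}) :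
  5%:R != 0 :> F -> ~ quad 'X %= d ^+ 2.
Proof.
move=> nz5 /eqpP [[c1 c2] /= /andP[nz_c1 nz_c2] /(congr1 (fun p : {poly F} => p : seq F)) E].
have sz_f : size (quad 'X : {poly F}) = 3%N.
  rewrite /quad -addrA size_polyDl size_polyXn // (leq_ltn_trans (size_polyD _ _)) //.
  by rewrite size_polyX size_polyN size_poly1.
have sz_d : (size d <= 2)%N.
  have := size_exp d 2; have <- : size (quad 'X : {poly F}) = size (d ^+ 2).
    by rewrite -(size_scale _ nz_c1) E size_scale.
  by rewrite sz_f; case: (size d) => [|[|[|n]]] //=; lia.
have d2 : d`_2 = 0 by rewrite nth_default.
have coefE0 i : c1 * (quad 'X)`_i = c2 * (d * d)`_i by rewrite -!coefZ -expr2 E.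
have := coefE0 0%N; have := coefE0 1%N; have := coefE0 2%N.
rewrite /quad !coefM !big_ord_recl !big_ord0 /= !(coefD, coefN, coefXn, coefX, coef1) /=.
rewrite d2 /bump /= !mul0r !mulr0 !addr0 !add0r !subr0 mulr1 => E2 E1 E0.
have /eqP : 5%:R * (c1 * c1) = 0.
  have -> : 5%:R * (c1 * c1) = c1 * c1 - 4%:R * c1 * (c1 * -1) by ring.
  by rewrite {1 2}E1 E0 E2; ring.
by rewrite !mulf_eq0 (negPf nz5) (negPf nz_c1).
Qed.

Section CharacterSums.
Variables (F : finFieldType) (h m : nat).
Hypothesis card_F : #|F| = (2 * h + 1)%N.
Local Notation chi := (@quad_char F).

Lemma size_quadX : size (quad 'X : {poly F}) = 3%N.
Proof.
rewrite /quad -addrA size_polyDl size_polyXn // (leq_ltn_trans (size_polyD _ _)) //.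
by rewrite size_polyX size_polyN size_poly1.
Qed.

Lemma size_cubicX : size (cubic 'X : {poly F}) = 4%N.
Proof.
have sz2 : (size ('X ^+ 2 - 'X *+ 2 + 1 : {poly F})%R <= 3)%N.
  rewrite (leq_trans (size_polyD _ _)) // size_poly1 geq_max andbT.
  rewrite (leq_trans (size_polyD _ _)) // size_polyXn size_polyN geq_max /=.
  by rewrite -mulr_natr -polyC_natr (leq_trans (size_polyMleq _ _)) // size_polyX size_polyC; case: (_ != 0).
have -> : cubic 'X = 'X ^+ 3 - ('X ^+ 2 - 'X *+ 2 + 1) :> {poly F} by rewrite /cubic; ring.
by rewrite size_polyDl size_polyXn // size_polyN ltnS.
Qed.

Lemma horner_quadX x : (quad 'X : {poly F}).[x] = quad x.
Proof. by rewrite /quad !hornerE. Qed.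

Lemma horner_cubicX x : (cubic 'X : {poly F}).[x] = cubic x.
Proof. by rewrite /cubic !hornerE. Qed.

(* The Bezout coefficients are integral, so coprimality holds in every
   characteristic. *)
Lemma coprime_cubic_quad : coprimep (cubic 'X) (quad 'X : {poly F}).
Proof.
apply/Bezout_eq1_coprimepP; rewrite /cubic /quad.
exists ('X *+ 5 + 8%:R, - (('X - 2%:R) * ('X *+ 5 + 8%:R) + 25%:R)) => /=; ring.
Qed.

Lemma coprime_cubic_reflect : coprimep (cubic 'X) (cubic (1 - 'X) : {poly F}).
Proof.
apply/Bezout_eq1_coprimepP; rewrite /cubic.
by exists ((1 - 'X) * ('X *+ 2 - 1) - 4%:R, - ('X * ('X *+ 2 - 1) + 4%:R)) => /=; ring.
Qed.

Definition char_sum (f : {poly F}) : int := \sum_x chi f.[x].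

Definition twisted_sum (G : F -> int) : int :=
  \sum_x (1 - chi x) * (1 - chi (1 - x)) * G x.

Let bound e : int := ((2 * e - 1) * #|F| + 4 * m * e)%:Z.

Lemma size_1X : size (1 - 'X : {poly F}) = 2%N.
Proof. by rewrite -opprB size_polyN size_XsubC. Qed.

(** Expanding the two factors leaves, besides [char_sum f], the sums for X f, (1 - X) f and X (1 -
    X) f. Each has a linear factor prime to its cofactor, as f(0) and f(1) are nonzero. *)
Lemma twisted_sum_leq (f : {poly F}) e1 e2 : (0 < e1)%N -> (0 < e2)%N ->
    f.[0] != 0 -> f.[1] != 0 ->
    (size f <= 2 * e1)%N -> (size f <= 2 * e2 - 1)%N ->
    (4 * m ^ 2 + e1 <= h)%N -> (4 * m ^ 2 + e2 <= h)%N ->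
  `|(2 * m)%:Z * (twisted_sum (fun x => chi f.[x]) - char_sum f)| <= bound e1 + bound e1 + bound e2.
Proof.
move=> e1_gt0 e2_gt0 f0 f1 sz1 sz2 le1 le2.
have nz_f : f != 0 by apply: contraNneq f0 => ->; rewrite horner0.
have nz1X : 1 - 'X != 0 :> {poly F} by rewrite -size_poly_eq0 size_1X.
have cop0 : coprimep 'X f by rewrite -['X]subr0 coprimep_sym coprimep_XsubC.
have cop1 : coprimep (1 - 'X) f.
  by rewrite coprimep_sym -opprB -scaleN1r coprimepZr ?oppr_eq0 ?oner_neq0 // coprimep_XsubC.
have cop01 : coprimep 'X ((1 - 'X) * f).
  rewrite coprimepMr cop0 andbT; apply/Bezout_eq1_coprimepP.
  by exists (1, 1) => /=; ring.
have sX (g : {poly F}) : (size ('X * g)%R <= (size g).+1)%N.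
  by rewrite (leq_trans (size_polyMleq _ _)) // size_polyX.
have s1X (g : {poly F}) : (size ((1 - 'X) * g)%R <= (size g).+1)%N.
  by rewrite (leq_trans (size_polyMleq _ _)) // size_1X.
have A0 : `|(2 * m)%:Z * char_sum ('X * f)| <= bound e1.
  apply: (quad_char_sum_leq card_F) => //; first by rewrite (leq_trans (sX f)) // addn1.
  by move=> c p r; apply: nonsquare_even_size; rewrite // ?size_polyX // mulf_neq0 // polyX_eq0.
have A1 : `|(2 * m)%:Z * char_sum ((1 - 'X) * f)| <= bound e1.
  apply: (quad_char_sum_leq card_F) => //; first by rewrite (leq_trans (s1X f)) // addn1.
  by move=> c p r; apply: nonsquare_even_size; rewrite // ?size_1X // mulf_neq0.
have A2 : `|(2 * m)%:Z * char_sum ('X * ((1 - 'X) * f))| <= bound e2.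
  apply: (quad_char_sum_leq card_F) => //.
    by rewrite (leq_trans (sX _)) // addn1 ltnS (leq_trans (s1X f)) //; lia.
  by move=> c p r; apply: nonsquare_even_size; rewrite // ?size_polyX // !mulf_neq0 // polyX_eq0.
have -> : twisted_sum (fun x => chi f.[x]) - char_sum f =
    char_sum ('X * ((1 - 'X) * f)) - char_sum ('X * f) - char_sum ((1 - 'X) * f).
  rewrite /twisted_sum /char_sum -!sumrB; apply: eq_bigr => x _.
  by rewrite !hornerM hornerD hornerN hornerX hornerC !(quad_charM card_F); ring.
move: A0 A1 A2; rewrite !mulrBr.
move: (_ * char_sum _) (_ * char_sum _) (_ * char_sum _) (bound e1) (bound e2) => *; lia.
Qed.

Lemma twisted_sum_reflect (G : F -> int) :
  twisted_sum (fun x => G (1 - x)) = twisted_sum G.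
Proof.
rewrite /twisted_sum [RHS](reindex_inj (can_inj (subKr (1 : F)))) /=.
by apply: eq_bigr => x _; rewrite subKr [X in _ = X * _]mulrC.
Qed.

(** Symmetric in a and 1 - a, as scaling by a nonsquare requires. Each of the last three clauses
    defeats one linear equation whose solution could otherwise have the prescribed characters. *)
Definition admissible (a : F) :=
  [&& chi a == -1, chi (1 - a) == -1, quad a != 0, quad (1 - a) != 0,
      ~~ ((chi (quad a) == 1) && (chi (cubic a) == 1)),
      ~~ ((chi (quad (1 - a)) == 1) && (chi (cubic (1 - a)) == 1))
    & ~~ ((chi (cubic a) == -1) && (chi (cubic (1 - a)) == -1))].

(* At most 0 for every pattern of characters that is not admissible.  It was
   found by linear programming, minimizing the bound on the character sums in
   the expansion of the product. *)
Definition weight (x : F) : int :=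
  (1 - chi x) * (1 - chi (1 - x)) *
  (1 - chi (quad x) - chi (quad (1 - x)) - chi (quad x) * chi (cubic x)
   - chi (quad (1 - x)) * chi (cubic (1 - x)) - chi (cubic x) * chi (cubic (1 - x))).

Lemma quad_char_cases x :
  [\/ chi x = -1, x = 0 /\ chi x = 0 | chi x = 1].
Proof.
rewrite /quad_char; case: eqP => [->|_]; first by constructor 2.
by case: is_square; [constructor 3 | constructor 1].
Qed.

Lemma quad_char0 : chi 0 = 0. Proof. by rewrite /quad_char eqxx. Qed.

Lemma quad_char1 : chi 1 = 1.
Proof. by rewrite (quad_char_exp card_F) expr1n eqxx (negPf (one_neqN1 card_F)). Qed.

Lemma quad_char_sqr x : x != 0 -> chi (x ^+ 2) = 1.
Proof.
move=> nz_x; rewrite expr2 (quad_charM card_F).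
by case: (quad_char_cases x) => [->|[x0 _]|->] //; rewrite x0 eqxx in nz_x.
Qed.

(** A root satisfies x^3 = (1 - x)^2, so chi x = chi(x)^3 = 1. Where chi x = -1, only zeros of
    [quad] can thus be exceptional for the weight. *)
Lemma cubic_eq0_quad_char x : cubic x = 0 -> chi x = 1.
Proof.
move=> c0; have x3 : x ^+ 3 = (1 - x) ^+ 2.
  by apply/subr0_eq; rewrite -c0 /cubic; ring.
have nz : 1 - x != 0.
  rewrite subr_eq0; apply/eqP=> x1; move: c0; rewrite -x1 /cubic !expr1n.
  rewrite subrr add0r mulr2n addrK => /eqP; by rewrite oner_eq0.
move: (quad_char_sqr nz); rewrite -x3 !exprS expr0 mulr1 !(quad_charM card_F).
by case: (quad_char_cases x) => [->|[_ ->]|->].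
Qed.

Lemma weight_leq x : ~~ admissible x ->
  weight x <= 16%:Z * (quad x == 0)%:R + 16%:Z * (quad (1 - x) == 0)%:R.
Proof.
rewrite /admissible /weight.
case: (quad_char_cases x) => [ax|[x0 ax]|ax]; last first.
- rewrite ax subrr !mul0r => _; rewrite addr_ge0 ?mulr_ge0 //.
- rewrite x0 subr0 quad_char1 subrr mulr0 mul0r => _; rewrite addr_ge0 ?mulr_ge0 //.
case: (quad_char_cases (1 - x)) => [bx|[x1 bx]|bx]; last first.
- rewrite bx subrr mulr0 !mul0r => _; rewrite addr_ge0 ?mulr_ge0 //.
- by move: ax; rewrite -(subKr 1 x) x1 subr0 quad_char1.
have nzc : cubic x <> 0 by move=> /cubic_eq0_quad_char; rewrite ax.
have nzc' : cubic (1 - x) <> 0 by move=> /cubic_eq0_quad_char; rewrite bx.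
rewrite ax bx !eqxx /=.
have cases y : [\/ chi y = -1 /\ (y == 0) = false, chi y = 0 /\ (y == 0) = true
                 | chi y = 1 /\ (y == 0) = false].
  rewrite /quad_char; case: eqP => _; first by constructor 2.
  by case: is_square; [constructor 3 | constructor 1].
by case: (quad_char_cases (cubic x)) => [->|[]//|->];
  case: (quad_char_cases (cubic (1 - x))) => [->|[]//|->];
  case: (cases (quad x)) => -[-> ->]; case: (cases (quad (1 - x))) => -[-> ->].
Qed.
End CharacterSums.

(* Expanding the weight gives [2 m \sum_x weight x >= (2 m - 93) q - 232 m],
   whereas only the at most four zeros of [quad x] and [quad (1 - x)]
   contribute positively, at most 16 each: hence the condition [47 <= m]. *)
Lemma exists_admissible (F : finFieldType) h m :
    #|F| = (2 * h + 1)%N -> 5%:R != 0 :> F -> (47 <= m)%N -> (4 * m ^ 2 + 4 <= h)%N ->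
  exists a : F, admissible a.
Proof.
move=> card_F nz5 m_large h_large; apply/existsP; apply: contraT; rewrite negb_exists => /forallP bad.
pose chi := @quad_char F.
have le_h e : (e <= 4)%N -> (4 * m ^ 2 + e <= h)%N.
  by move=> le_e; apply: leq_trans h_large; rewrite leq_add2l.
pose P1 : {poly F} := 1; pose P2 : {poly F} := quad 'X.
pose P5 : {poly F} := cubic 'X * quad 'X; pose P6 : {poly F} := cubic 'X * cubic (1 - 'X).
have [quad_0 quad_1] : quad (0 : F) = -1 /\ quad (1 : F) = 1.
  by rewrite /quad expr0n expr1n /= add0r sub0r addrK.
have [cubic_0 cubic_1] : cubic (0 : F) = -1 /\ cubic (1 : F) = 1.
  by rewrite /cubic !expr0n !expr1n /= subrr mul0rn !add0r subrr add0r mulr2n addrK.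
have nzN1 : -1 != 0 :> F by rewrite oppr_eq0 oner_neq0.
have E2 x : P2.[x] = quad x by apply: horner_quadX.
have E5 x : P5.[x] = cubic x * quad x by rewrite hornerM horner_quadX horner_cubicX.
have horner_cubic1X x : (cubic (1 - 'X) : {poly F}).[x] = cubic (1 - x).
  by rewrite /cubic !hornerE.
have E6 x : P6.[x] = cubic x * cubic (1 - x) by rewrite hornerM horner_cubicX horner_cubic1X.
have sz_c1 : size (cubic (1 - 'X) : {poly F}) = 4%N.
  have -> : cubic (1 - 'X) = cubic 'X \Po (1 - 'X) :> {poly F}.
    by rewrite /cubic !(rmorphB, rmorphD, rmorphXn, rmorphMn, rmorph1) /= comp_polyX.
  by rewrite size_comp_poly2 ?size_1X // size_cubicX.
have nz_q : quad 'X != 0 :> {poly F} by rewrite -size_poly_eq0 size_quadX.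
have nz_c : cubic 'X != 0 :> {poly F} by rewrite -size_poly_eq0 size_cubicX.
have nz_c1 : cubic (1 - 'X) != 0 :> {poly F} by rewrite -size_poly_eq0 sz_c1.
have sz5 : size P5 = 6%N by rewrite size_mul // size_quadX size_cubicX.
have sz6 : size P6 = 7%N by rewrite size_mul // sz_c1 size_cubicX.
have S1 : char_sum P1 = #|F|%:Z.
  rewrite /char_sum; under eq_bigr => x _ do rewrite hornerC (quad_char1 card_F).
  by rewrite sumr_const natz.
have S2 : `|(2 * m)%N%:Z * char_sum P2| <= (1 * #|F| + 4 * m * 1)%:Z.
  apply: (quad_char_sum_leq card_F (m := m) (e := 1)) => //; rewrite ?size_quadX ?le_h //.
  move=> c p r; rewrite -[P2]mulr1 => eq_p; apply/eqP; apply: contraT => nz_p.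
  have [] := coprime_factor_sqr _ _ nz_p eq_p; rewrite ?coprimep1 ?mulr1 // => d.
  by move/(quad_not_sqr nz5).
have S5 : `|(2 * m)%N%:Z * char_sum P5| <= (5 * #|F| + 4 * m * 3)%:Z.
  apply: (quad_char_sum_leq card_F (m := m) (e := 3)) => //; rewrite ?sz5 ?le_h //.
  move=> c p r; apply: nonsquare_even_size; rewrite ?size_cubicX ?mulf_neq0 //.
  exact: coprime_cubic_quad.
have S6 : `|(2 * m)%N%:Z * char_sum P6| <= (5 * #|F| + 4 * m * 3)%:Z.
  apply: (quad_char_sum_leq card_F (m := m) (e := 3)) => //; rewrite ?sz6 ?le_h //.
  move=> c p r; apply: nonsquare_even_size; rewrite ?size_cubicX ?mulf_neq0 //.
  exact: coprime_cubic_reflect.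
have T1 := @twisted_sum_leq F h m card_F P1 1 1 isT isT.
have T2 := @twisted_sum_leq F h m card_F P2 2 2 isT isT.
have T5 := @twisted_sum_leq F h m card_F P5 3 4 isT isT.
have T6 := @twisted_sum_leq F h m card_F P6 4 4 isT isT.
rewrite !hornerC oner_neq0 size_poly1 !le_h // in T1.
rewrite !E2 !(quad_0, quad_1) nzN1 oner_neq0 size_quadX !le_h // in T2.
rewrite !E5 !(quad_0, quad_1) !(cubic_0, cubic_1) mulrNN mulr1 oner_neq0 sz5 !le_h // in T5.
rewrite !E6 !(cubic_0, cubic_1) subr0 subrr !(cubic_0, cubic_1) mulr1 mul1r nzN1 sz6 !le_h // in T6.
move: {T1}(T1 isT isT isT isT isT isT) {T2}(T2 isT isT isT isT isT isT).
move: {T5}(T5 isT isT isT isT isT isT) {T6}(T6 isT isT isT isT isT isT).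
have W_sum : \sum_(x : F) weight x = twisted_sum (fun x => chi P1.[x])
    - 2 * twisted_sum (fun x => chi P2.[x]) - 2 * twisted_sum (fun x => chi P5.[x])
    - twisted_sum (fun x => chi P6.[x]).
  transitivity (twisted_sum (fun x => chi P1.[x]) - twisted_sum (fun x => chi P2.[x])
    - twisted_sum (fun x => chi P2.[1 - x]) - twisted_sum (fun x => chi P5.[x])
    - twisted_sum (fun x => chi P5.[1 - x]) - twisted_sum (fun x => chi P6.[x])).
    rewrite /twisted_sum -!sumrB; apply: eq_bigr => x _.
    rewrite !E2 !E5 !E6 hornerC /chi (quad_char1 card_F) !(quad_charM card_F) /weight.
    by ring.
  rewrite (twisted_sum_reflect (fun x => chi P2.[x])).
  by rewrite (twisted_sum_reflect (fun x => chi P5.[x])); ring.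
have W_leq : \sum_(x : F) weight x <= 64%:Z.
  have roots2 : \sum_(x : F) (quad x == 0)%:R <= 2%:Z.
    have := card_roots_leq nz_q; rewrite size_quadX /= => le2.
    rewrite -natr_sum natz lez_nat; apply: leq_trans le2.
    rewrite -sum1dep_card [X in (_ <= X)%N]big_mkcond leq_sum // => x _.
    by rewrite horner_quadX; case: eqP.
  apply: le_trans (ler_sum _ (fun x _ => weight_leq card_F (bad x))) _.
  rewrite big_split /= -!mulr_sumr [X in _ + _ * X](reindex_inj (can_inj (subKr (1 : F)))) /=.
  under [X in _ + _ * X]eq_bigr => x _ do rewrite subKr.
  by move: roots2; move: (\sum_x _) => S; lia.
(* The errors in multiples of q are 3 for [P1], 9 + 1 for [P2], 17 + 5 for [P5] and 21 + 5 for [P6];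
   with [P2] and [P5] doubled by reflection, 3 + 20 + 44 + 26 = 93. As 2m >= 94, this forces q <=
   (232 + 128)m, against q >= 8m^2 >= 376m. *)
have q_large : (376 * m <= #|F|)%N by rewrite card_F; move: h_large; rewrite expnS expn1; nia.
have mq_large : (94 * #|F| <= 2 * m * #|F|)%N by rewrite leq_mul2r; apply/orP; right; lia.
rewrite S1; move: S2 S5 S6 mq_large.
have : (2 * m)%N%:Z * \sum_(x : F) weight x <= (128 * m)%N%:Z.
  have -> : (128 * m)%N%:Z = (2 * m)%N%:Z * 64%:Z by lia.
  by apply: ler_wpM2l.
rewrite W_sum !mulrBr !(mulrCA _ 2%Z).
have -> : (2 * m)%N%:Z * #|F|%:Z = (2 * m * #|F|)%N%:Z by [].
move: (_ * twisted_sum (fun x => chi P1.[x])) (_ * twisted_sum (fun x => chi P2.[x]))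
  (_ * twisted_sum (fun x => chi P5.[x])) (_ * twisted_sum (fun x => chi P6.[x])).
move: (_ * char_sum P2) (_ * char_sum P5) (_ * char_sum P6) (2 * m * #|F|)%N.
move: #|F| q_large m_large; clear => q; lia.
Qed.

(** * Admissible elements give maximally nonassociative quasigroups *)

Section Quasigroup.
Variables (F : finFieldType) (h : nat).
Hypothesis card_F : #|F| = (2 * h + 1)%N.
Hypothesis even_h : ~~ odd h.
Local Notation chi := (@quad_char F).
Let chiM := quad_charM card_F.

Lemma quad_charN x : chi (- x) = chi x.
Proof.
rewrite -mulN1r chiM (quad_char_exp card_F (-1)) -signr_odd (negPf even_h) expr0.
by rewrite eqxx (negPf (one_neqN1 card_F)) mul1r.
Qed.

Lemma psi_quad_char (a b x : F) : psi a b x = if chi x == -1 then b * x else a * x.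
Proof.
by rewrite /psi /quad_char; have [->|_] := eqVneq x 0; [rewrite !mulr0 !if_same | case: is_square].
Qed.

Lemma psiN (a b x : F) : psi a b (- x) = - psi a b x.
Proof. by rewrite !psi_quad_char quad_charN !mulrN; case: ifP. Qed.

Lemma psiM (a b x y : F) :
  x != 0 -> psi a b (x * y) = x * (if chi x == -1 then psi b a y else psi a b y).
Proof.
move=> nz_x; rewrite !psi_quad_char chiM.
by case: (quad_char_cases x) => [->|[x0 _]|->]; first last; rewrite ?mul1r ?x0 ?eqxx // in nz_x *;
  case: (quad_char_cases y) => [->|[-> ->]|->] /=; rewrite ?mulr0 //; rewrite mulrCA.
Qed.

(** Under these hypotheses [psi] negates [chi], so equal images come from the same branch. *)
Lemma psi_inj (a b : F) : chi a = -1 -> chi b = -1 -> injective (psi a b).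
Proof.
move=> ax bx.
have chi_psi x : chi (psi a b x) = - chi x.
  by rewrite psi_quad_char; case: ifP => _; rewrite chiM ?ax ?bx mulN1r.
have nz c : chi c = -1 -> c != 0 by move=> cx; apply/eqP => c0; rewrite c0 quad_char0 in cx.
move=> x y eq_xy; have := congr1 chi eq_xy; rewrite !chi_psi => /oppr_inj chi_xy.
move: eq_xy; rewrite !psi_quad_char chi_xy.
by case: ifP => _ /mulfI; apply; apply: nz.
Qed.

Lemma orthomorphism_psi (a : F) :
  chi a = -1 -> chi (1 - a) = -1 -> orthomorphism (psi a (1 - a)).
Proof.
move=> ax bx; split; apply: injF_bij; first exact: psi_inj.
have psiB x : psi a (1 - a) x - x = - psi (1 - a) a x.
  by rewrite !psi_quad_char; case: ifP => _; ring.
by move=> x y; rewrite !psiB => /oppr_inj; apply: psi_inj.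
Qed.

(** x * c = d reads f(c - x) - (c - x) = d - c, and c * y = d reads f(y - c) = d - c: each bijection
    solves one equation. *)
Lemma quasigroup_of_orthomorphism (V : zmodType) (f : V -> V) :
  orthomorphism f -> quasigroup (fun x y => x + f (y - x)).
Proof.
move=> [[g fK gK] [g' f'K g'K]] c d; split.
  exists (c - g' (d - c)); split => [|x <-].
    by have {}g'K := g'K (d - c); rewrite subKr addrAC -addrA g'K addrC subrK.
  have -> : x + f (c - x) - c = f (c - x) - (c - x) by rewrite opprB addrCA addrA.
  by have {}f'K := f'K (c - x); rewrite f'K subKr.
exists (g (d - c) + c); split => [|y <-]; first by rewrite addrK gK addrC subrK.
by rewrite addrAC subrr add0r fK subrK.
Qed.

Lemma admissible_swap (a : F) : admissible a -> admissible (1 - a).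
Proof. by rewrite /admissible subKr => /and5P[-> -> -> ->] /and3P[-> -> +]; rewrite andbC => ->. Qed.

(* Associativity of the triple [x, 0, z] with [x = 1]: each of the eight
   combinations of the characters of [z] and of the two outer arguments of
   [psi] makes the equation linear in [z], and its solution contradicts
   these characters. *)
Lemma admissible_no_solution (a z : F) : admissible a ->
  psi a (1 - a) (psi a (1 - a) z - 1) <> - a + psi a (1 - a) (z - (1 - a)).
Proof.
case/and5P => /eqP ax /eqP bx nz_fa nz_fb /and3P[].
move b_eq : (1 - a) bx nz_fb => b bx nz_fb nfa nfb ng.
have nz c : chi c = -1 -> c != 0 by move=> cx; apply/eqP => c0; rewrite c0 quad_char0 in cx.
have nz_a := nz a ax; have nz_b := nz b bx.
have chi_a2 := quad_char_sqr card_F nz_a; have chi_b2 := quad_char_sqr card_F nz_b.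
have chi_pm u : u != 0 -> (chi u == -1) = false -> chi u = 1.
  by move=> nz_u; case: (quad_char_cases u) => [->|[u0 _]|->] //; rewrite u0 eqxx in nz_u.
rewrite psi_quad_char [psi a b z]psi_quad_char [psi a b (z - b)]psi_quad_char.
have [-> E | nz_z] := eqVneq z 0.
  have chi_Nb : chi (0 - b) == -1 by rewrite sub0r quad_charN bx.
  have chi_N1 : chi (0 - 1) == -1 = false by rewrite sub0r quad_charN (quad_char1 card_F).
  rewrite quad_char0 /= mulr0 chi_N1 chi_Nb in E.
  have /eqP : b * b = a * (0 - 1) - (- a + b * (0 - b)) by ring.
  by rewrite E subrr mulf_eq0 (negPf nz_b).
have [zx | zx] : chi z = -1 \/ chi z = 1.
- by case: (quad_char_cases z) => [|[z0 _]|]; [left | rewrite z0 eqxx in nz_z | right].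
- rewrite zx eqxx; case: ifP => tx; case: ifP => sx /eqP; rewrite -subr_eq0.
  + have -> : b * (b * z - 1) - (- a + b * (z - b)) = a * (a - b * z) by rewrite -b_eq; ring.
    rewrite mulf_eq0 (negPf nz_a) subr_eq0 => /eqP a_eq.
    by have := ax; rewrite a_eq chiM bx zx.
  + have -> : b * (b * z - 1) - (- a + a * (z - b)) = quad b * (z - 1) by rewrite -b_eq /quad; ring.
    rewrite mulf_eq0 (negPf nz_fb) subr_eq0 => /eqP z1.
    by move: zx; rewrite z1 (quad_char1 card_F).
  + have -> : a * (b * z - 1) - (- a + b * (z - b)) = b * b * (1 - z) by rewrite -b_eq; ring.
    rewrite !mulf_eq0 (negPf nz_b) subr_eq0 => /eqP z1.
    by move: zx; rewrite -z1 (quad_char1 card_F).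
  + have -> : a * (b * z - 1) - (- a + a * (z - b)) = a * (b - a * z) by rewrite -b_eq; ring.
    rewrite mulf_eq0 (negPf nz_a) subr_eq0 => /eqP b_az.
    by have := bx; rewrite b_az chiM ax zx.
have nz_t : a * z - 1 != 0.
  by rewrite subr_eq0; apply/eqP => /(congr1 chi); rewrite chiM ax zx (quad_char1 card_F).
have nz_s : z - b != 0 by rewrite subr_eq0; apply/eqP => z_b; rewrite z_b bx in zx.
rewrite zx /=; case: ifP => tx; case: ifP => sx /eqP; rewrite -subr_eq0.
- have -> : b * (a * z - 1) - (- a + b * (z - b)) = a ^+ 2 - b ^+ 2 * z by rewrite -b_eq; ring.
  (* From b^2 z = a^2, b^2 (a z - 1) = a^3 - b^2 and b^2 (z - b) = a^2 - b^3, so the two cubics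
     inherit the characters of the arguments of [psi]. *)
  rewrite subr_eq0 => /eqP z_eq; case/negP: ng; apply/andP; split; apply/eqP.
    have -> : cubic a = b ^+ 2 * (a * z - 1).
      by rewrite mulrBr mulrCA -z_eq /cubic -b_eq; ring.
    by rewrite chiM chi_b2 (eqP tx).
  have -> : cubic b = - (b ^+ 2 * (z - b)).
    by rewrite mulrBr -z_eq /cubic -b_eq; ring.
  by rewrite quad_charN chiM chi_b2 (eqP sx).
- have -> : b * (a * z - 1) - (- a + a * (z - b)) = - (a ^+ 2 * z + quad b).
    by rewrite -b_eq /quad; ring.
  rewrite oppr_eq0 addr_eq0 => /eqP z_eq; case/negP: nfb; apply/andP; split; apply/eqP.
    by rewrite -[quad b]opprK -z_eq quad_charN chiM chi_a2 zx.
  have -> : cubic b = - (a ^+ 2 * (z - b)).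
    by rewrite mulrBr z_eq /cubic /quad -b_eq; ring.
  by rewrite quad_charN chiM chi_a2 chi_pm.
- have -> : a * (a * z - 1) - (- a + b * (z - b)) = quad a * z + b ^+ 2.
    by rewrite -b_eq /quad; ring.
  rewrite addr_eq0 => /eqP z_eq; case/negP: nfa.
  have chi_fa : chi (quad a) = 1 
    by have := congr1 chi z_eq; rewrite chiM zx mulr1 quad_charN chi_b2.
  rewrite chi_fa eqxx /=; apply/eqP.
  have -> : cubic a = - (quad a * (a * z - 1)).
    by rewrite mulrBr mulrCA z_eq /cubic /quad -b_eq; ring.
  by rewrite quad_charN chiM chi_fa chi_pm.
have -> : a * (a * z - 1) - (- a + a * (z - b)) = a * b * (1 - z) by rewrite -b_eq; ring.
rewrite !mulf_eq0 (negPf nz_a) (negPf nz_b) subr_eq0 => /eqP z1; move: tx.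
by rewrite -z1 mulr1 -opprB b_eq quad_charN bx.
Qed.

Theorem admissible_maximally_nonassociative (a : F) :
  admissible a -> Q_maximally_nonassociative_quasigroup a (1 - a).
Proof.
move=> adm; have /and5P[/eqP ax /eqP bx _ _ _] := adm.
have ortho := orthomorphism_psi ax bx.
split=> //; first exact: quasigroup_of_orthomorphism.
pose P := psi a (1 - a).
suff base X Z : P (P Z - X) = P (- X) + P (Z - X - P (- X)) -> X = 0 /\ Z = 0.
  move=> x y z; rewrite /Qop -/P => E.
  have [|xy zy] := base (x - y) (z - y); last first.
    by split; apply/eqP; rewrite -subr_eq0 ?xy // -opprB zy oppr0.
  rewrite !opprB; apply: (addrI x).
  have -> : P (z - y) + (y - x) = y + P (z - y) - x by ring.
  have -> : z - y + (y - x) - P (y - x) = z - (x + P (y - x)) by ring.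
  by rewrite addrA.
have nz c : chi c = -1 -> c != 0 by move=> cx; apply/eqP => c0; rewrite c0 quad_char0 in cx.
have nz_a := nz a ax; have nz_b := nz _ bx.
have P0 : P 0 = 0 by rewrite /P psi_quad_char !mulr0 if_same.
have [-> | nz_X] := eqVneq X 0.
  (* The equation becomes P (P Z) = P Z, hence P Z = Z; a nonzero Z would make one of a, 1 - a equal
     to 1 and the other 0. *)
  rewrite oppr0 P0 subr0 !addr0 add0r => /(psi_inj ax bx); rewrite /P psi_quad_char => E; split=> //.
  apply/eqP; apply: contraT => nz_Z; rewrite -[RHS]mul1r in E.
  case: ifP E => _ /(mulIf nz_Z) E; first by rewrite -(subKr 1 a) E subrr eqxx in nz_a.
  by rewrite E subrr eqxx in nz_b.
have [c0 [c0_adm P_c0]] : exists c, admissible c /\ forall y, P (X * y) = X * psi c (1 - c) y.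
  rewrite /P; case: (boolP (chi X == -1)) => chiX; last first.
    by exists a; split=> // y; rewrite psiM // (negPf chiX).
  by exists (1 - a); split=> [|y]; [apply: admissible_swap | rewrite psiM // chiX subKr].
have [z ->] : exists z, Z = X * z by exists (Z / X); rewrite mulrC divfK.
pose p := psi c0 (1 - c0); rewrite P_c0 -/p.
have -> : X * p z - X = X * (p z - 1) by ring.
have -> : P (- X) = X * p (-1) by rewrite -P_c0 mulrN1.
have -> : X * z - X - X * p (-1) = X * (z - 1 - p (-1)) by ring.
rewrite /p !P_c0 -mulrDr => /(mulfI nz_X).
have -> : psi c0 (1 - c0) (-1) = - c0.
  by rewrite psiN psi_quad_char (quad_char1 card_F) /= mulr1.
rewrite (_ : z - 1 - - c0 = z - (1 - c0)); last by ring.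
by move/(admissible_no_solution c0_adm).
Qed.
End Quasigroup.

(** * Fields of order less than 17681 *)

(* Lists of coefficients, low degree first, of polynomials over [F_p] modulo
   [t^k - red(t)] where [k = size red]. *)
Section ListArithmetic.
Variables (p : N) (red : seq N).

Fixpoint addl (u v : seq N) : seq N :=
  match u, v with
  | a :: u', b :: v' => N.modulo (N.add a b) p :: addl u' v'
  | [::], _ => v
  | _, [::] => u
  end.

Definition scalel c u : seq N := [seq N.modulo (N.mul c a) p | a <- u].

Definition oppl u := scalel (N.pred p) u.

(** Only a list of exactly the length of [red] is reduced; any other is merely shifted, which also
    represents the product, so correctness holds for every list. *)
Definition mulXl (u : seq N) : seq N :=
  if u is a :: u' then
    if size u == size red
    then addl (0%num :: belast a u') (scalel (last a u') red)
    else 0%num :: u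
  else [::].

Definition mull (u v : seq N) : seq N :=
  foldr (fun a acc => addl (scalel a v) (mulXl acc)) [::] u.

Fixpoint expl (u : seq N) (n : positive) : seq N :=
  match n with
  | xH => u
  | xO n' => let w := expl u n' in mull w w
  | xI n' => let w := expl u n' in mull u (mull w w)
  end.

Definition constl c (u : seq N) : bool :=
  if u is a :: u' then N.eqb a c && all (N.eqb 0) u' else false.

Definition onel : seq N := [:: 1%num].

Definition quadl u := addl (addl (mull u u) u) (oppl onel).

Definition cubicl u :=
  let u2 := mull u u in addl (addl (addl (mull u u2) (oppl u2)) (addl u u)) (oppl onel).

(** A pattern stronger than [admissible]: a nonsquare [quadl a] and a square [cubicl a] settle two
    of the three exclusions at once. *)
Definition witnessl (h : positive) a :=
  let pos u := constl 1 (expl u h) in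
  let neg u := constl (N.pred p) (expl u h) in
  let b := addl onel (oppl a) in
  let fb := quadl b in
  [&& neg a, neg b, neg (quadl a), pos (cubicl a)
    & neg fb || (pos fb && neg (cubicl b))].

(* [t^q = t] modulo [t^k - red(t)], so that this polynomial has a root in the
   field of order [q]. *)
Definition splitsl (q : positive) :=
  let x := mulXl onel in (0 < size red)%N && all (N.eqb 0) (addl (expl x q) (oppl x)).

End ListArithmetic.

(** Here [h] stands for (q - 1) / 2. When [red] is [[:: 0]] the modulus is t, with root 0, and the
    computation takes place in the prime field. *)
Definition check_field (p : N) (q h : positive) red a := splitsl p red q && witnessl p red h a.

(** The odd primes below 133, where 133^2 > 17681. *)
Definition small_primes : seq N := [:: 3; 5; 7; 11; 13; 17; 19; 23; 29; 31; 37; 41; 43; 47;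
  53; 59; 61; 67; 71; 73; 79; 83; 89; 97; 101; 103; 107; 109; 113; 127; 131]%num.

Definition small_composite (n : N) :=
  has (fun d => N.ltb d n && N.eqb (N.modulo n d) 0) small_primes.

(* [ws] lists one witness for each prime, other than 5 and 17, met in the
   progression [n], [n + 4], [n + 8], etc. *)
Fixpoint scan_primes (fuel : nat) (n : N) (ws : seq N) : bool :=
  if fuel is fuel'.+1 then
    if [|| N.eqb n 1, N.eqb n 5, N.eqb n 17 | small_composite n]
    then scan_primes fuel' (N.add n 4) ws
    else if ws is w :: ws' then
      match n with
      | Npos q => check_field n q (Pos.div2 q) [:: 0%num] [:: w]
                  && scan_primes fuel' (N.add n 4) ws'
      | N0 => false
      end
    else false
  else true.

Definition prime_witnesses : seq N := [::
  6; 11; 18; 7; 20; 24; 34; 15; 14; 73; 18; 47; 96; 11; 74; 59; 8; 20; 57; 30; 21; 38;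
  56; 60; 32; 27; 42; 42; 14; 31; 113; 28; 97; 23; 60; 97; 62; 19; 15; 34; 31; 79; 41;
  15; 18; 92; 12; 43; 52; 63; 33; 90; 171; 89; 19; 41; 31; 48; 24; 114; 43; 12; 67; 19;
  27; 136; 12; 103; 153; 11; 77; 15; 15; 67; 32; 85; 42; 116; 47; 39; 22; 60; 48; 33;
  91; 6; 88; 27; 19; 62; 103; 13; 20; 78; 42; 28; 66; 7; 107; 8; 60; 60; 8; 103; 7; 34;
  31; 30; 41; 39; 46; 22; 35; 12; 14; 147; 14; 24; 114; 28; 51; 27; 14; 31; 20; 28; 22;
  13; 46; 97; 125; 20; 58; 66; 19; 30; 44; 38; 15; 6; 6; 60; 72; 89; 31; 60; 23; 34; 13;
  77; 38; 42; 30; 47; 35; 13; 58; 31; 30; 19; 91; 105; 35; 6; 40; 95; 19; 63; 30; 187;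
  13; 11; 29; 69; 14; 28; 58; 8; 34; 56; 15; 14; 75; 22; 8; 21; 13; 98; 137; 8; 45; 77;
  14; 52; 66; 6; 35; 67; 12; 45; 45; 30; 28; 7; 89; 6; 21; 107; 108; 53; 7; 47; 67; 31;
  97; 11; 29; 130; 84; 92; 83; 80; 51; 40; 33; 35; 58; 45; 31; 62; 53; 15; 20; 30; 38;
  15; 8; 43; 33; 68; 80; 7; 73; 57; 20; 15; 7; 6; 44; 14; 41; 27; 7; 15; 39; 83; 15; 27;
  35; 46; 47; 47; 62; 58; 20; 89; 12; 22; 21; 33; 28; 31; 54; 8; 141; 19; 40; 29; 11;
  111; 6; 41; 108; 38; 29; 15; 35; 21; 21; 61; 8; 8; 31; 27; 11; 57; 45; 30; 42; 41; 78;
  32; 34; 24; 23; 39; 38; 30; 110; 68; 62; 20; 18; 57; 63; 33; 185; 7; 120; 28; 40; 6;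
  97; 80; 71; 13; 20; 133; 71; 68; 23; 98; 21; 42; 78; 69; 67; 41; 46; 32; 109; 57; 11;
  11; 48; 40; 46; 46; 109; 46; 55; 14; 42; 62; 83; 33; 52; 38; 89; 146; 45; 24; 29; 67;
  20; 72; 46; 20; 56; 18; 61; 72; 33; 55; 46; 22; 7; 38; 7; 34; 12; 48; 20; 42; 39; 62;
  60; 11; 84; 42; 12; 21; 30; 53; 18; 63; 51; 38; 24; 8; 53; 40; 43; 62; 85; 8; 44; 11;
  83; 31; 56; 112; 27; 92; 93; 7; 41; 34; 51; 33; 31; 45; 47; 18; 7; 54; 41; 56; 32; 20;
  98; 27; 59; 43; 41; 22; 11; 70; 7; 23; 30; 12; 20; 18; 15; 24; 113; 68; 74; 8; 29; 18;
  21; 29; 19; 133; 6; 27; 14; 41; 47; 28; 45; 60; 27; 70; 8; 31; 11; 75; 35; 39; 46; 7;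
  11; 18; 13; 55; 41; 47; 32; 7; 74; 12; 22; 6; 6; 38; 30; 66; 22; 27; 47; 19; 38; 12;
  22; 61; 115; 18; 27; 7; 124; 19; 23; 44; 168; 184; 30; 61; 13; 55; 20; 33; 76; 6; 71;
  71; 54; 14; 7; 89; 73; 8; 12; 107; 21; 18; 8; 12; 60; 19; 111; 13; 14; 68; 165; 18;
  43; 80; 11; 48; 153; 14; 43; 54; 59; 22; 77; 76; 89; 114; 29; 24; 28; 74; 34; 30; 46;
  11; 6; 75; 8; 30; 22; 15; 52; 12; 88; 70; 32; 20; 28; 24; 6; 22; 8; 24; 30; 30; 19;
  22; 7; 22; 43; 93; 45; 23; 165; 41; 12; 96; 66; 23; 7; 72; 95; 43; 21; 55; 6; 35; 24;
  7; 27; 31; 33; 111; 112; 12; 161; 8; 32; 8; 34; 40; 8; 12; 43; 45; 52; 23; 41; 155;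
  39; 11; 72; 67; 54; 55; 19; 23; 6; 31; 30; 106; 51; 6; 28; 13; 15; 72; 84; 12; 41; 27;
  47; 74; 13; 14; 30; 8; 56; 15; 46; 30; 46; 6; 149; 23; 40; 20; 11; 53; 34; 46; 45; 20;
  60; 18; 112; 55; 23; 88; 91; 22; 12; 80; 60; 42; 8; 45; 23; 20; 18; 12; 6; 33; 13; 52;
  99; 27; 40; 13; 77; 94; 7; 22; 44; 51; 34; 133; 40; 15; 14; 6; 68; 58; 42; 38; 32; 24;
  23; 13; 113; 22; 30; 93; 29; 40; 7; 141; 89; 23; 62; 67; 97; 84; 29; 18; 55; 60; 99;
  236; 89; 111; 6; 18; 40; 47; 15; 88; 23; 85; 23; 7; 46; 28; 91; 6; 39; 24; 98; 60; 76;
  51; 35; 35; 34; 8; 13; 182; 6; 42; 12; 132; 20; 106; 31; 7; 90; 15; 38; 23; 8; 110;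
  43; 136; 131; 6; 6; 67; 12; 21; 41; 95; 28; 119; 42; 53; 21; 86; 21; 6; 45; 87; 15;
  24; 140; 15; 53; 76; 27; 47; 31; 58; 30; 12; 109; 20; 28; 32; 40; 39; 8; 27; 58; 110;
  45; 70; 61; 14; 54; 6; 91; 42; 89; 39; 47; 24; 12; 7; 109; 66; 88; 53; 89; 53; 7; 42;
  11; 8; 15; 31; 40; 40; 79; 13; 15; 48; 38; 30; 30; 23; 8; 68; 51; 31; 54; 18; 43; 56;
  13; 15; 6; 11; 23; 24; 53; 42; 90; 67; 105; 67; 127; 46; 30; 59; 6; 133; 14; 55; 139;
  31; 7; 8; 218; 68; 13; 54; 44; 28; 80; 18; 55; 30; 34; 52; 35; 68; 57; 89; 55; 56;
  147; 13; 27; 12; 8; 61; 30; 15; 13; 35; 40; 30; 43; 6; 55; 44; 42; 33; 24; 24; 130;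
  19; 33; 74; 14; 89; 34; 20; 15; 11; 6; 32; 119; 112; 41; 61; 78; 96; 6; 63; 15; 27;
  12; 34; 22; 14; 31; 7; 41; 48; 104; 33; 84; 57; 19; 58; 77; 52; 89; 35; 41; 15; 41;
  66; 14; 6; 20; 19; 89; 66; 12; 116; 31; 24; 23; 7; 12; 23; 41; 87; 12; 22; 125; 63; 8;
  187; 30; 11; 23; 28; 59; 28; 24; 41; 14]%num.

(* Entries [(p, n, red, a)] for the field of order [p ^ n]. *)
Definition prime_power_witnesses : seq (N * N * seq N * seq N) := [::
  (3, 2, [:: 1; 1], [:: 0; 1]);
  (3, 4, [:: 1; 0; 0; 1], [:: 0; 1; 0; 1]);
  (3, 6, [:: 1; 1], [:: 0; 1]);
  (3, 8, [:: 1; 0; 0; 0; 0; 0; 1; 0], [:: 0; 0; 0; 1; 1; 0; 1; 2]);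
  (7, 2, [:: 1; 1], [:: 1; 2]);
  (7, 4, [:: 1; 0; 0; 2], [:: 0; 0; 5; 3]);
  (11, 2, [:: 1; 2], [:: 0; 6]);
  (11, 4, [:: 1; 0; 0; 3], [:: 0; 0; 1; 10]);
  (13, 2, [:: 1; 1], [:: 2; 10]);
  (13, 3, [:: 0], [:: 6]);
  (17, 2, [:: 1; 1], [:: 2; 7]);
  (17, 3, [:: 1; 0; 3], [:: 0; 3; 12]);
  (19, 2, [:: 1; 2], [:: 0; 18]);
  (23, 2, [:: 1; 1], [:: 0; 1]);
  (29, 2, [:: 1; 2], [:: 2; 20]);
  (31, 2, [:: 1; 3], [:: 0; 14]);
  (37, 2, [:: 1; 1], [:: 2; 6]);
  (41, 2, [:: 1; 3], [:: 2; 14]);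
  (43, 2, [:: 1; 1], [:: 0; 6]);
  (47, 2, [:: 1; 1], [:: 0; 1]);
  (53, 2, [:: 1; 1], [:: 2; 40]);
  (59, 2, [:: 1; 2], [:: 0; 12]);
  (61, 2, [:: 1; 2], [:: 2; 32]);
  (67, 2, [:: 1; 1], [:: 0; 1]);
  (71, 2, [:: 1; 3], [:: 0; 8]);
  (73, 2, [:: 1; 1], [:: 2; 34]);
  (79, 2, [:: 1; 5], [:: 0; 7]);
  (83, 2, [:: 1; 1], [:: 0; 18]);
  (89, 2, [:: 1; 3], [:: 2; 2]);
  (97, 2, [:: 1; 1], [:: 2; 9]);
  (101, 2, [:: 1; 2], [:: 2; 9]);
  (103, 2, [:: 1; 1], [:: 0; 1]);
  (107, 2, [:: 1; 1], [:: 0; 4]);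
  (109, 2, [:: 1; 2], [:: 2; 6]);
  (113, 2, [:: 1; 1], [:: 2; 9]);
  (127, 2, [:: 1; 1], [:: 0; 11]);
  (131, 2, [:: 1; 2], [:: 0; 19])]%num.

Definition check_prime_power (e : N * N * seq N * seq N) : bool :=
  let: (p, n, red, a) := e in
  match N.pow p n with
  | Npos q => check_field p q (Pos.div2 q) red a
  | N0 => false
  end.

(** The ranges suffice because 133^2 = 17689 and 3^9 = 19683 both exceed 17681; even p fail the
    congruence modulo 4. *)
Definition prime_powers_covered : bool :=
  all (fun p => all (fun n =>
      let q := N.pow p n in
      [|| N.leb 17681 q, negb (N.eqb (N.modulo q 4) 1), N.eqb p 5, small_composite p
        | has (fun e => N.eqb e.1.1.1 p && N.eqb e.1.1.2 n) prime_power_witnesses])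
    [:: 2; 3; 4; 5; 6; 7; 8]%num)
  [seq N.of_nat p | p <- iota 3 130].

(** The 4420 numbers 1 + 4i scanned are those below 17681. *)
Lemma scan_primesT : scan_primes (N.to_nat 4420) 1 prime_witnesses.
Proof. by vm_compute. Qed.

Lemma check_prime_powersT : all check_prime_power prime_power_witnesses.
Proof. by vm_compute. Qed.

Lemma prime_powers_coveredT : prime_powers_covered.
Proof. by vm_compute. Qed.

(** * Coefficient lists as polynomials over F modulo t^k - red(t) *)

Section ListArithmeticCorrect.
Variables (F : finFieldType) (p : N) (red : seq N).
Hypothesis p_char : (N.to_nat p)%:R = 0 :> F.
Hypothesis p_neq0 : p <> 0%num.

Let cst (a : N) : {poly F} := (N.to_nat a)%:R.

Definition evall (u : seq N) : {poly F} := foldr (fun a P => cst a + 'X * P) 0 u.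

Let modulus : {poly F} := 'X^(size red) - evall red.
Let eqm (P Q : {poly F}) := modulus %| P - Q.

Lemma cst_char : cst p = 0.
Proof. by rewrite /cst -polyC_natr p_char. Qed.

Lemma cst_modulo a : cst (N.modulo a p) = cst a.
Proof.
rewrite {2}(N.div_mod a p p_neq0) /cst N2Nat.inj_add N2Nat.inj_mul.
by rewrite plusE multE natrD natrM -/(cst p) cst_char mul0r add0r.
Qed.

Lemma evall_addl u v : evall (addl p u v) = evall u + evall v.
Proof.
elim: u v => [|a u IHu] [|b v] /=; rewrite ?add0r ?addr0 //.
rewrite cst_modulo IHu /cst N2Nat.inj_add plusE natrD; ring.
Qed.

Lemma evall_scalel c u : evall (scalel p c u) = cst c * evall u.
Proof.
elim: u => [|a u IHu] /=; first by rewrite mulr0.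
rewrite cst_modulo IHu /cst N2Nat.inj_mul multE natrM; ring.
Qed.

Lemma cst_pred : cst (N.pred p) = -1.
Proof.
apply/eqP; rewrite -addr_eq0 -cst_char /cst -{2}(N.succ_pred p p_neq0).
by rewrite N2Nat.inj_succ -addn1 natrD.
Qed.

Lemma evall_oppl u : evall (oppl p u) = - evall u.
Proof. by rewrite evall_scalel cst_pred mulN1r. Qed.

Lemma evall_rcons u c : evall (rcons u c) = evall u + cst c * 'X^(size u).
Proof.
elim: u => [|a u IHu] /=; first by rewrite mulr0 add0r addr0 expr0 mulr1.
by rewrite IHu exprS; ring.
Qed.

Lemma size_evall u : (size (evall u) <= size u)%N.
Proof.
elim: u => [|a u IHu] /=; first by rewrite size_poly0.
rewrite /cst -polyC_natr (leq_trans (size_polyD _ _)) // geq_max.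
rewrite (leq_trans (size_polyC_leq1 _)) //= (leq_trans (size_polyMleq _ _)) //.
by rewrite size_polyX.
Qed.

Lemma eqm_refl P : eqm P P. Proof. by rewrite /eqm subrr dvdp0. Qed.

Lemma eqm_trans P Q R : eqm P Q -> eqm Q R -> eqm P R.
Proof. by rewrite /eqm -[P - R](subrKA Q); apply: dvdp_add. Qed.

Lemma eqm_sym P Q : eqm P Q -> eqm Q P.
Proof. by rewrite /eqm -[Q - P]opprB dvdpNr. Qed.

Lemma eqmD P Q P' Q' : eqm P Q -> eqm P' Q' -> eqm (P + P') (Q + Q').
Proof. by move=> d d'; rewrite /eqm opprD addrACA dvdp_add. Qed.

Lemma eqmM P Q P' Q' : eqm P Q -> eqm P' Q' -> eqm (P * P') (Q * Q').
Proof.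
move=> d d'; rewrite /eqm; have -> : P * P' - Q * Q' = P * (P' - Q') + (P - Q) * Q' by ring.
by apply: dvdp_add; [apply: dvdp_mull | apply: dvdp_mulr].
Qed.

Lemma eqm_mulXl u : eqm (evall (mulXl p red u)) ('X * evall u).
Proof.
case: u => [|a u]; first by rewrite /= mulr0 eqm_refl.
rewrite /mulXl; case: eqP => [sz | _]; last by rewrite /= /cst add0r eqm_refl.
rewrite evall_addl evall_scalel [a :: u]lastI evall_rcons /= size_belast.
rewrite /eqm (_ : cst 0 = 0) // add0r; rewrite /= in sz.
set e := evall _; set c := cst _.
have -> : 'X * e + c * evall red - 'X * (e + c * 'X^(size u)) = - c * modulus.
  by rewrite /modulus -sz exprS; ring.
by rewrite dvdp_mull.
Qed.

Lemma eqm_mull u v : eqm (evall (mull p red u v)) (evall u * evall v).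
Proof.
elim: u => [|a u IHu] /=; first by rewrite mul0r eqm_refl.
rewrite evall_addl evall_scalel mulrDl eqmD ?eqm_refl //.
by apply: eqm_trans (eqm_mulXl _) _; rewrite -mulrA eqmM ?eqm_refl.
Qed.

Lemma eqm_expl u n : eqm (evall (expl p red u n)) (evall u ^+ Pos.to_nat n).
Proof.
elim: n => [n IHn|n IHn|] /=; last by rewrite eqm_refl.
- rewrite Pos2Nat.inj_xI multE exprS mul2n -addnn exprD.
  apply: eqm_trans (eqm_mull _ _) _; apply: eqmM (eqm_refl _) _.
  by apply: eqm_trans (eqm_mull _ _) _; apply: eqmM.
rewrite Pos2Nat.inj_xO multE mul2n -addnn exprD.
by apply: eqm_trans (eqm_mull _ _) _; apply: eqmM.
Qed.

Lemma evall_all0 u : all (N.eqb 0) u -> evall u = 0.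
Proof.
by elim: u => //= -[|//] u IHu /IHu ->; rewrite /cst mulr0 addr0.
Qed.

Lemma evall_constl c u : constl c u -> evall u = cst c.
Proof.
by case: u => //= a u /andP[/N.eqb_eq -> /evall_all0 ->]; rewrite mulr0 addr0.
Qed.

Lemma evall_onel : evall onel = 1.
Proof. by rewrite /= mulr0 addr0. Qed.

(** The modulus divides X^q - X, a product of distinct linear factors over F, so it is associate to
    a subproduct, nonempty because its degree is positive. *)
Lemma splitsl_root q : Pos.to_nat q = #|F| -> splitsl p red q ->
  exists t, modulus.[t] = 0.
Proof.
move=> q_card /andP[k_gt0 /evall_all0].
rewrite evall_addl evall_oppl => /subr0_eq xq.
have eq_x : eqm (evall (mulXl p red onel)) 'X.
  by have := eqm_mulXl onel; rewrite evall_onel mulr1.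
have eq_xn n : eqm (evall (mulXl p red onel) ^+ n) ('X^n).
  by elim: n => [|n IHn]; rewrite ?eqm_refl // !exprS eqmM.
have dvd_X : modulus %| 'X^#|F| - 'X.
  have := eqm_expl (mulXl p red onel) q; rewrite xq q_card => e1.
  exact: eqm_trans (eqm_sym (eq_xn _)) (eqm_trans (eqm_sym e1) eq_x).
rewrite finField_genPoly in dvd_X.
have [s dvd_s] := dvdp_prod_XsubC dvd_X.
have sz_m : size modulus = (size red).+1.
  by rewrite size_polyDl size_polyXn // size_polyN ltnS size_evall.
case E: (mask s (index_enum F)) dvd_s => [|t s'] dvd_s.
  by have := eqp_size dvd_s; rewrite big_nil size_poly1 sz_m; case: (size red) k_gt0.
exists t; apply/rootP; rewrite (eqp_root dvd_s) big_cons rootM root_XsubC eqxx //.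
Qed.

Lemma witnessl_admissible h t a :
    #|F| = (2 * Pos.to_nat h + 1)%N -> modulus.[t] = 0 -> witnessl p red h a ->
  admissible (evall a).[t].
Proof.
move=> card_F m0.
(* Evaluation at a root of the modulus turns congruences into equalities, so [val] carries list
   arithmetic to arithmetic in F. *)
have eqm_val P Q : eqm P Q -> P.[t] = Q.[t].
  case/dvdpP => R /(congr1 (fun S : {poly F} => S.[t])).
  by rewrite hornerD hornerN hornerM m0 mulr0 => /subr0_eq.
pose val u := (evall u).[t].
have val1 : val onel = 1 by rewrite /val evall_onel hornerC.
have valD u v : val (addl p u v) = val u + val v by rewrite /val evall_addl hornerD.
have valN u : val (oppl p u) = - val u by rewrite /val evall_oppl hornerN.
have valM u v : val (mull p red u v) = val u * val v.
  by rewrite /val (eqm_val _ _ (eqm_mull u v)) hornerM.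
have val_quad u : val (quadl p red u) = quad (val u).
  by rewrite /quadl !(valD, valN, valM, val1).
have val_cubic u : val (cubicl p red u) = cubic (val u).
  by rewrite /cubicl !(valD, valN, valM, val1) /cubic; ring.
have valX u : val (expl p red u h) = val u ^+ Pos.to_nat h.
  by rewrite /val (eqm_val _ _ (eqm_expl u h)) horner_exp.
have chi1 u : constl 1 (expl p red u h) -> quad_char (val u) = 1.
  move/evall_constl => /(congr1 (fun S : {poly F} => S.[t])); rewrite -/(val _) valX.
  rewrite (quad_char_exp card_F) => ->.
  by rewrite /cst hornerC eqxx (negPf (one_neqN1 card_F)).
have chiN1 u : constl (N.pred p) (expl p red u h) -> quad_char (val u) = -1.
  move/evall_constl => /(congr1 (fun S : {poly F} => S.[t])); rewrite -/(val _) valX.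
  rewrite (quad_char_exp card_F) => ->.
  by rewrite cst_pred hornerN hornerC eqxx eq_sym (negPf (one_neqN1 card_F)).
have nz (x : F) c : c != 0 -> quad_char x = c -> x != 0.
  by move=> nz_c; apply: contra_eqN => /eqP ->; rewrite quad_char0 eq_sym.
rewrite /witnessl => /and5P[/chiN1 ax /chiN1 bx /chiN1 fa /chi1 ga fb].
rewrite -/(val a) valD valN val1 val_quad val_cubic in bx fa ga fb *.
rewrite /admissible ax bx fa ga (nz _ (-1) isT fa) //=.
case/orP: fb => [/chiN1 fb | /andP[/chi1 fb /chiN1 gb]];
  rewrite val_quad valD valN val1 in fb; first by rewrite (nz _ (-1) isT fb) // fb.
rewrite val_cubic valD valN val1 in gb.
by rewrite (nz _ 1 isT fb) // fb gb.
Qed.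
End ListArithmeticCorrect.

(** * From the computed tables to all fields of small order *)

Lemma small_compositeP (x : N) : small_composite x -> ~~ prime (N.to_nat x).
Proof.
case/hasP => d d_small /andP[/N.ltb_lt lt_dx /N.eqb_eq mod0].
have d_gt1 : (1 < d)%num.
  apply/N.ltb_lt; have : all (N.ltb 1) small_primes by [].
  by move/allP/(_ d d_small).
have dvd_d : (N.to_nat d %| N.to_nat x)%N.
  apply/dvdnP; exists (N.to_nat (N.div x d)).
  by rewrite {1}(N.div_mod x d) ?mod0; lia.
apply/negP => /primeP[_ /(_ _ dvd_d)]; lia.
Qed.

Lemma scan_primesP fuel n ws i : scan_primes fuel n ws -> (i < fuel)%N ->
  let x := (n + 4 * N.of_nat i)%num in
  [\/ x = 1%num, x = 5%num, x = 17%num | small_composite x] \/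
  exists q w, x = Npos q /\ check_field x q (Pos.div2 q) [:: 0%num] [:: w].
Proof.
elim: fuel n ws i => // fuel IHf n ws [|i] /=.
  move=> + _; rewrite N.add_0_r; case: ifP => [/or4P[/N.eqb_eq|/N.eqb_eq|/N.eqb_eq|] H _ | _].
  - by left; constructor 1.
  - by left; constructor 2.
  - by left; constructor 3.
  - by left; constructor 4.
  case: ws => // w ws; case: n => // q /andP[check _]; right.
  by exists q, w.
move=> scan lt_i; have [ws' scan'] : exists ws', scan_primes fuel (n + 4) ws'.
  move: scan; case: ifP => _; first by exists ws.
  by case: ws => // w ws; case: n => // q /andP[_ scan]; exists ws.
have := IHf _ _ i scan' lt_i.
by have -> : (n + 4 + 4 * N.of_nat i = n + 4 * N.pos (Pos.of_succ_nat i))%num by lia.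
Qed.

Lemma exists_admissible_small (F : finFieldType) :
    #|F| = 1 %[mod 4] -> 5%N \notin [pchar F] -> #|F| <> 17%N ->
    (N.of_nat #|F| < 17681)%num ->
  exists a : F, admissible a.
Proof.
move=> q_mod4 char5 q_neq17 q_small.
have q_mod : (#|F| %% 4 = 1)%N by rewrite q_mod4.
have [p p_pr p_char] := finPcharP F.
have p_neq5 : p <> 5%N by move=> p5; rewrite p5 in p_char; rewrite p_char in char5.
have q_gt1 := finNzRing_gt1 F.
have [n q_eq] : exists n, #|F| = (p ^ n)%N by eexists; apply: card_pprimeChar p_char.
have check (P : N) (Q : positive) red a :
    N.to_nat P = p -> Pos.to_nat Q = #|F| -> check_field P Q (Pos.div2 Q) red a ->
  exists a : F, admissible a.
  move=> P_eq Q_eq /andP[split wit].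
  have P0 : (N.to_nat P)%:R = 0 :> F by rewrite P_eq (pcharf0 p_char).
  have nzP : P <> 0%num by move=> P0'; rewrite -P_eq P0' in p_pr.
  have [t mt] := splitsl_root P0 nzP Q_eq split.
  have card_F : #|F| = (2 * Pos.to_nat (Pos.div2 Q) + 1)%N.
    rewrite -Q_eq in q_mod q_gt1 *; clear -q_mod q_gt1.
    case: Q q_mod q_gt1 => [Q|Q|] //=; first by rewrite Pos2Nat.inj_xI; lia.
    by rewrite Pos2Nat.inj_xO; lia.
  by exists (evall F a).[t]; apply: witnessl_admissible card_F mt wit.
case: n q_eq => [|[|n]] q_eq; first by rewrite q_eq expn0 in q_gt1.
  rewrite expn1 in q_eq; have p_gt1 := prime_gt1 p_pr.
  have lt_i : (p %/ 4 < N.to_nat 4420)%N by lia.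
  have p_eq : N.of_nat p = (1 + 4 * N.of_nat (p %/ 4))%num by lia.
  case: (scan_primesP scan_primesT lt_i); rewrite -p_eq.
    case=> [p1|p5|p17|/small_compositeP]; [lia | lia | lia |].
    by rewrite Nat2N.id p_pr.
  case=> Q [w [Q_eq /check]]; apply; first by rewrite Nat2N.id.
  by rewrite q_eq; lia.
have p_ge3 : (2 < p)%N.
  have := prime_gt1 p_pr; rewrite leq_eqVlt => /predU1P[p2|//].
  by move: q_mod; rewrite q_eq -p2 !expnS mulnA modnMr.
have pn_leq : (p ^ 2 <= p ^ n.+2)%N by rewrite leq_exp2l // ltnW.
have p_small : (p < 133)%N by rewrite ltnNge; apply/negP => p_large; nia.
have n_small : (n < 7)%N.
  rewrite ltnNge; apply/negP => n_large.
  have : (3 ^ 9 <= p ^ n.+2)%N.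
    by apply: (@leq_trans (3 ^ n.+2)); rewrite ?leq_exp2l ?leq_exp2r.
  rewrite -q_eq; lia.
have pow_eq : N.to_nat (N.pow (N.of_nat p) (N.of_nat n.+2)) = #|F|.
  rewrite q_eq; elim: n.+2 => [|k IHk] //.
  rewrite Nat2N.inj_succ N.pow_succ_r' N2Nat.inj_mul Nat2N.id IHk multE.
  by rewrite expnS.
have p_in : N.of_nat p \in [seq N.of_nat k | k <- iota 3 130].
  by apply: map_f; rewrite mem_iota p_ge3.
have n_in : N.of_nat n.+2 \in [:: 2; 3; 4; 5; 6; 7; 8]%num.
  by case: n n_small {q_eq pn_leq pow_eq} => [|[|[|[|[|[|[|]]]]]]].
have /allP/(_ _ p_in)/allP/(_ _ n_in) := prime_powers_coveredT.
case/orP => [/N.leb_le | ].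
  by move: pow_eq q_small; move: (N.pow _ _) => Q; lia.
case/orP => [/negP[] | ].
  apply/N.eqb_eq; move: pow_eq q_mod; move: (N.pow _ _) => Q Q_eq.
  have := N.mod_lt Q 4 ltac:(by []); have := N.div_mod Q 4 ltac:(by []).
  by move: (N.div Q 4) (N.modulo Q 4) => u v; lia.
case/or3P => [/N.eqb_eq | /small_compositeP | /hasP[[[[P k] red] a]] e_in /andP[]].
- by lia.
- by rewrite Nat2N.id p_pr.
move=> /N.eqb_eq /= P_eq /N.eqb_eq /= k_eq.
have /allP/(_ _ e_in) := check_prime_powersT.
rewrite /check_prime_power P_eq k_eq; move: pow_eq.
case: (N.pow _ _) => [|Q] //= Q_eq; apply: check Q_eq.
by rewrite Nat2N.id.
Qed.

Theorem theorem4p3 (F : finFieldType)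
    (hq1 : #|F| = 1 %[mod 4])
    (hchar : 5%N \notin [pchar F])
    (hq17 : #|F| <> 17%N) :
  exists a : F, Q_maximally_nonassociative_quasigroup a (1 - a).
Proof.
have q_mod : (#|F| %% 4 = 1)%N by rewrite hq1.
pose h := (2 * (#|F| %/ 4))%N.
have card_F : #|F| = (2 * h + 1)%N by rewrite /h; lia.
have even_h : ~~ odd h by rewrite oddM.
suff [a adm] : exists a : F, admissible a.
  by exists a; apply: (admissible_maximally_nonassociative card_F even_h).
(* 17681 = 2(4 m^2 + 4) + 1 for m = 47, the least m with 2m > 93. *)
have [large | small] := N.le_gt_cases 17681 (N.of_nat #|F|); last first.
  exact: exists_admissible_small.
have nz5 : 5%:R != 0 :> F.
  by apply: contra hchar => char5; rewrite inE /= char5.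
by apply: (exists_admissible (m := 47) card_F nz5); rewrite // -mulnn; lia.
Qed.
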